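(* Let $(X,d)$ be a compact metric space, let $m\ge2$, and let $\mathcal S=(X^m,(\phi_j)_{j\in\{1,\dots,n\}},(q_j)_{j\in\{1,\dots,n\}})$ be a generalized iterated function system with probabilities consisting of $(a_1,\dots,a_m)$-contractions, where $\sum_{i=1}^m a_i<1$. Let $A_{\mathcal S}$ be its attractor and $\mu_{\mathcal S}$ its Hutchinson measure. Then the joint evaluation map $EV_{\mathcal S}:\Gamma\to\Gamma$, $EV_{\mathcal S}(B,\nu)=(A_{\mathcal R_{B,\nu}},\mu_{\mathcal R_{B,\nu}})$, is a Lipschitz contraction on $(\Gamma,d_{max})$ with $$\operatorname{Lip}(EV_{\mathcal S})\le\max\left(\operatorname{Lip}(F_{\mathcal S}),\ \frac{\sum_{i=2}^m a_i}{1-a_1}\right)<1.$$ In particular, for any $(B_0,\nu_0)\in\Gamma$ the sequence $(EV_{\mathcal S}^k(B_0,\nu_0))_{k\ge0}$ converges to $(A_{\mathcal S},\mu_{\mathcal S})\in\Gamma$.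
   Context: $\mathcal K^*(X)$ is the set of nonempty compact subsets of $X$ (equal to the set $\mathcal B^*(X)$ of nonempty closed bounded subsets, since $X$ is compact) with the Hausdorff-Pompeiu metric $h$. $\mathcal M_1(X)$ is the set of Borel probability measures on $X$ with the Monge-Kantorovich metric $d_{MK}(\mu,\nu)=\sup\{|\int f\,d\mu-\int f\,d\nu|: f:X\to\mathbb R,\ \operatorname{Lip}(f)\le1\}$. $\Gamma=\{(B,\nu): B\in\mathcal K^*(X),\ \nu\in\mathcal M_1(X),\ \operatorname{supp}(\nu)\subseteq B\}$ with $d_{max}((B,\nu),(B',\nu'))=\max(h(B,B'),d_{MK}(\nu,\nu'))$. For nonnegative reals $a_1,\dots,a_m$ with $\sum a_i<1$, a map $\phi:X^m\to X$ is an $(a_1,\dots,a_m)$-contraction if $d(\phi(x_1,\dots,x_m),\phi(y_1,\dots,y_m))\le\sum_{i=1}^m a_i d(x_i,y_i)$ for all points of $X^m$. A generalized iterated function system with probabilities (GIFSp) is a finite family of Lipschitz maps $\phi_j:X^m\to X$, $j=1,\dots,n$, with weights $q_j>0$, $\sum_j q_j=1$. Its Hutchinson operator is $F_{\mathcal S}(A_1,\dots,A_m)=\bigcup_{j=1}^n\phi_j(A_1\times\cdots\times A_m)$ on $\mathcal K^*(X)^m$, and $\operatorname{Lip}(F_{\mathcal S})$ is its Lipschitz constant with respect to the maximum metric on $\mathcal K^*(X)^m$ (induced by $h$) and $h$. Its generalized Markov operator $M_{\mathcal S}:\mathcal M_1(X)^m\to\mathcal M_1(X)$ is defined by $\int f\,dM_{\mathcal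 S}(\mu_1,\dots,\mu_m)=\sum_{j=1}^n q_j\int_{X^m}f\circ\phi_j\,d(\mu_1\times\cdots\times\mu_m)$ for continuous $f:X\to\mathbb R$. When all $\phi_j$ are $(a_1,\dots,a_m)$-contractions, it is known that there is a unique $A_{\mathcal S}\in\mathcal K^*(X)$ with $F_{\mathcal S}(A_{\mathcal S},\dots,A_{\mathcal S})=A_{\mathcal S}$ (the attractor), and a unique $\mu_{\mathcal S}\in\mathcal M_1(X)$ with $M_{\mathcal S}(\mu_{\mathcal S},\dots,\mu_{\mathcal S})=\mu_{\mathcal S}$ (the Hutchinson measure), and that $\operatorname{supp}(\mu_{\mathcal S})=A_{\mathcal S}$. For $(B,\nu)\in\Gamma$, the induced infinite iterated function system with probabilities is $\mathcal R_{B,\nu}=(X,(\psi_\theta)_{\theta\in\Theta},p)$ with $\Theta=B^{m-1}\times\{1,\dots,n\}$, $\psi_\theta(x)=\phi_j(x,b_2,\dots,b_m)$ for $\theta=(b_2,\dots,b_m,j)$, and $p$ the Borel probability on $\Theta$ given by $\int_\Theta f\,dp=\int_B\cdots\int_B\sum_{j=1}^n q_j f(b_2,\dots,b_m,j)\,d\nu(b_2)\cdots d\nu(b_m)$. Its attractor $A_{\mathcal R_{B,\nu}}$ is the unique set $A\in\mathcal K^*(X)$ with $A=\overline{\bigcup_{\theta\in\Theta}\psi_\theta(A)}$. Its Markov operator $M_{\mathcal R_{B,\nu}}:\mathcal M_1(X)\to\mathcal M_1(X)$ is $\int f\,dM_{\mathcal R_{B,\nu}}(\mu)=\int_X\int_\Theta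 f(\psi_\theta(x))\,dp(\theta)\,d\mu(x)$ for continuous $f$, and its Hutchinson measure $\mu_{\mathcal R_{B,\nu}}$ is the unique fixed point of $M_{\mathcal R_{B,\nu}}$. One has $(A_{\mathcal R_{B,\nu}},\mu_{\mathcal R_{B,\nu}})\in\Gamma$. *)

(* Defs.v *)
From HB Require Import structures.
From mathcomp Require Import all_boot all_order all_algebra.
From mathcomp Require Import all_classical all_reals all_analysis.
Import Order.TTheory GRing.Theory Num.Theory.
Import numFieldNormedType.Exports.

Set Implicit Arguments.
Unset Strict Implicit.
Unset Printing Implicit Defensive.

Local Open Scope classical_set_scope.
Local Open Scope ring_scope.

(* Nonempty metric spaces: [measurableType] requires a distinguished point. *)
#[short(type="pmetricType")]
HB.structure Definition PMetric (K : numDomainType) :=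
  { T of Metric K T & Pointed T }.

Notation borel X := (g_sigma_algebraType (@open X)).

HB.instance Definition _ (n : nat) := isPointed.Build 'I_n.+1 ord0.

HB.instance Definition _ (n : nat) := @isMeasurable.Build default_measure_display
  'I_n.+1 discrete_measurable discrete_measurable0
  discrete_measurableC discrete_measurableU.

Section Lipschitz_constant.
Context {R : realType} {T U : Type}.
Variables (D : set T) (dT : T -> T -> R) (dU : U -> U -> R).
Implicit Types (f : T -> U) (c : R).

Definition lipschitz_with c f :=
  0 <= c /\ forall x y, D x -> D y -> dU (f x) (f y) <= c * dT x y.

(* Extended-real valued, so that a map which is not Lipschitz gets [+oo]. *)
Definition Lip f : \bar R :=
  ereal_inf [set c%:E | c in [set c | lipschitz_with c f]].

Definition lipschitz_contraction f := exists2 c, c < 1 & lipschitz_with c f.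

End Lipschitz_constant.

Definition dmaxm (R : realType) (T : Type) (dT : T -> T -> R) (m : nat)
  (s t : 'I_m -> T) : R := \big[Num.max/0]_(i < m) dT (s i) (t i).

Arguments dmaxm {R T} dT {m} s t.

Section hyperspace_and_measures.
Context {R : realType} (X : pmetricType R).

Definition Kstar : set (set X) := [set A | compact A /\ A !=set0].

(* Only meaningful on [Kstar], where the suprema and infima are over nonempty
   bounded sets. *)
Definition hausdorff_dist (A B : set X) : R :=
  Num.max (sup [set inf [set mdist x y | y in B] | x in A])
          (sup [set inf [set mdist x y | x in A] | y in B]).

Definition lip1 (f : X -> R) := forall x y, `|f x - f y| <= mdist x y.

(* A term of [probability] also takes arbitrary values on non-measurable sets,
   so [dMK] vanishes exactly on the pairs that agree on Borel sets; equality of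
   Borel measures is to be read in that sense. *)
Definition dMK (mu nu : probability (borel X) R) : R :=
  sup [set `|\int[mu]_x f x - \int[nu]_x f x| | f in lip1].

Definition supp (mu : probability (borel X) R) : set X :=
  [set x | forall U : set X, open_nbhs x U -> (0 < mu U)%E].

Definition Gamma : set (set X * probability (borel X) R) :=
  [set g | Kstar g.1 /\ supp g.2 `<=` g.1].

Definition dmax (g g' : set X * probability (borel X) R) : R :=
  Num.max (hausdorff_dist g.1 g'.1) (dMK g.2 g'.2).

End hyperspace_and_measures.

Arguments Kstar {R} X.
Arguments Gamma {R} X.
Arguments hausdorff_dist {R X} A B.
Arguments dmax {R X} g g'.

Section product_of_probabilities.
Context d (T : measurableType d) (R : realType).

Definition tuple_cons (k : nat) (xt : T * k.-tuple T) : k.+1.-tuple T :=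
  [tuple of xt.1 :: xt.2].

Lemma measurable_tuple_cons k : measurable_fun setT (@tuple_cons k).
Proof. exact: measurable_cons. Qed.

HB.instance Definition _ k :=
  isMeasurableFun.Build _ _ _ _ (@tuple_cons k) (@measurable_tuple_cons k).

(* mu_0 x ... x mu_(k-1) on T^k *)
Fixpoint prod_probability (k : nat) :
    ('I_k -> probability T R) -> probability (k.-tuple T) R :=
  match k with
  | 0 => fun=> \d_([tuple] : 0.-tuple T)
  | k.+1 => fun mu => distribution
      (mu ord0 \x prod_probability (fun i => mu (lift ord0 i)))%E
      (@tuple_cons k)
  end.

End product_of_probabilities.

Section generalized_ifs.
Context {R : realType} (X : pmetricType R).

(* The family is indexed by 'I_n.+1: as the weights sum to 1 it is nonempty. *)
Record gifsp (m n : nat) := GIFSp {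
  gmap : 'I_n.+1 -> m.-tuple X -> X ;
  weight : 'I_n.+1 -> R ;
  gmap_lipschitz : forall j, exists c, lipschitz_with setT
    (fun s t => dmaxm mdist (tnth s) (tnth t)) mdist c (gmap j) ;
  weight_gt0 : forall j, 0 < weight j ;
  weight_sum1 : \sum_j weight j = 1 }.

Definition tuple_contraction (m : nat) (a : 'I_m -> R) (phi : m.-tuple X -> X) :=
  forall s t, mdist (phi s) (phi t) <= \sum_(i < m) a i * mdist (tnth s i) (tnth t i).

Context {m n : nat} (S : gifsp m n).

Definition hutchinson_op (A : 'I_m -> set X) : set X :=
  \bigcup_j (gmap S j @` [set t | forall i, A i (tnth t i)]).

(* nu = M_S(mu_1, ..., mu_m) *)
Definition is_markov_image (mu : 'I_m -> probability (borel X) R)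
    (nu : probability (borel X) R) :=
  forall f : X -> R, continuous f -> \int[nu]_x f x =
    \sum_j weight S j * \int[prod_probability mu]_t f (gmap S j t).

Definition attractor : set X :=
  xget set0 [set A | Kstar X A /\ hutchinson_op (fun=> A) = A].

Definition hutchinson_measure : probability (borel X) R :=
  xget (\d_(point : borel X) : probability _ _)
    [set mu | is_markov_image (fun=> mu) mu].

End generalized_ifs.

Section infinite_ifs.
Context {R : realType} (X : pmetricType R).

Record iifsp d (T : measurableType d) := IIFSp {
  index_set : set T ;
  imap : T -> X -> X ;
  index_probability : probability T R }.

Context {d : measure_display} {T : measurableType d} (S : iifsp T).

Definition iattractor : set X :=
  xget set0 [set A | Kstar X A /\
    A = closure (\bigcup_(theta in index_set S) (imap S theta @` A))].

(* nu = M_S(mu) *)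
Definition is_imarkov_image (mu nu : probability (borel X) R) :=
  forall f : X -> R, continuous f -> \int[nu]_x f x =
    \int[mu]_x \int[index_probability S]_(theta in index_set S) f (imap S theta x).

Definition ihutchinson_measure : probability (borel X) R :=
  xget (\d_(point : borel X) : probability _ _)
    [set mu | is_imarkov_image mu mu].

End infinite_ifs.

Section weight_measure.
Local Open Scope ereal_scope.
Context {R : realType} {X : pmetricType R} {m n : nat} (S : gifsp X m n).

(* sum_j q_j delta_j *)
Definition weight_measure (J : set 'I_n.+1) : \bar R :=
  \sum_(j < n.+1) (weight S j)%:E * \d_j J.

Let weight_measure0 : weight_measure set0 = 0.
Proof. by rewrite /weight_measure big1// => j _; rewrite measure0 mule0. Qed.

Let weight_measure_ge0 J : 0 <= weight_measure J.
Proof.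
by apply: sume_ge0 => j _; rewrite mule_ge0// lee_fin ltW// weight_gt0.
Qed.

Let weight_measure_sigma_additive : semi_sigma_additive weight_measure.
Proof.
pose w (k : nat) : {nonneg R} := NngNum (ltW (weight_gt0 S (inord k))).
pose mu := msum (fun k => mscale (w k) \d_(inord k : 'I_n.+1)) n.+1.
have -> : weight_measure = mu.
  apply/funext => J; rewrite /mu /msum /weight_measure; apply: eq_bigr => j _.
  by rewrite inord_val /mscale /w /= inord_val.
exact: (@measure_semi_sigma_additive _ _ R mu).
Qed.

HB.instance Definition _ := isMeasure.Build _ _ _ weight_measure
  weight_measure0 weight_measure_ge0 weight_measure_sigma_additive.

Let weight_measure_setT : weight_measure setT = 1.
Proof.
rewrite /weight_measure (eq_bigr (fun j => (weight S j)%:E)).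
  by rewrite sumEFin weight_sum1.
by move=> j _; rewrite diracT mule1.
Qed.

HB.instance Definition _ :=
  Measure_isProbability.Build _ _ _ weight_measure weight_measure_setT.

End weight_measure.

Section evaluation_map.
Context {R : realType} {X : pmetricType R} {p n : nat} (S : gifsp X p.+1 n).

(* Here m = p + 1, so that Theta = B^p x {0, ..., n} and the probability on
   Theta is nu x ... x nu x sum_j q_j delta_j. *)
Definition induced_iifsp (g : set X * probability (borel X) R) :
    iifsp X (p.-tuple (borel X) * 'I_n.+1)%type :=
  @IIFSp R X _ (p.-tuple (borel X) * 'I_n.+1)%type
    [set theta | forall i, g.1 (tnth theta.1 i)]
    (fun theta x => gmap S theta.2 [tuple of x :: theta.1])
    (prod_probability (fun=> g.2) \x weight_measure S)%E.

Definition EV (g : set X * probability (borel X) R) :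
    set X * probability (borel X) R :=
  (iattractor (induced_iifsp g), ihutchinson_measure (induced_iifsp g)).

End evaluation_map.

(* Main.v *)
Require Import Defs.
From HB Require Import structures.
From mathcomp Require Import all_boot all_order all_algebra.
From mathcomp Require Import all_classical all_reals all_analysis measurable_realfun.
From mathcomp Require Import lra.
Import Order.TTheory GRing.Theory Num.Theory.
Import numFieldNormedType.Exports.

(** The image of [(B, nu)] under the evaluation map consists of a set [A] and a
measure [mu] that solve fixed-point equations depending on [(B, nu)]: the attractor
equation is [A = F(A, B, ..., B)], where [F] is the generalized Hutchinson operator
(the union over the parameters is already closed, by compactness), and the invariance
equation is [mu = M(mu, nu, ..., nu)], where [M] is the generalized Markov operator
(by Fubini's theorem, [is_imarkov_imageE]). Contraction estimates for [F] and [M] in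
all their arguments therefore turn into contraction estimates for the solutions.

For sets, let [l] be the Lipschitz constant of [F], which is at most the sum of the
[a i] and so below [1]. Two solutions satisfy [h(A, A') <= l * max(h(A, A'), h(B, B'))],
and [l < 1] forces [h(A, A') <= l * h(B, B')] ([fixed_set_dist]). For measures, [M]
contracts the i-th argument by [a i] ([markov_image_contraction]), so the distance of
two solutions is at most [a ord0] times itself plus the sum of the other [a i] times
the distance of the parameters; solving gives the second term of the bound
([fixed_measure_dist]). The attractor and the Hutchinson measure of the system solve
the equations of their own image, hence are fixed by the evaluation map up to distance
zero, and the iterates converge to them geometrically.

The solutions have to exist. For sets, a monotone operator on compact sets has a
greatest fixed point ([monotone_Kstar_fixpoint]), which is not empty because each map
[x |-> phi (x, b, ..., b)] has a fixed point. For measures, contraction makes the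
integrals of Lipschitz functions converge along the Picard iteration; the limit is a
positive functional on Lipschitz functions, which the Riesz-Markov theorem represents
by a measure ([riesz_representation], [dMK_contraction_fixpoint]). That measure is
built as an outer measure from the values of the functional on test functions of open
sets, restricted to Borel sets by the theorem of Caratheodory.

The solution [mu] is supported in [A] because the integral of the distance to [A]
against [mu] is at most a constant less than [1] times itself, hence vanishes
([markov_image_infdist], [supp_subset]). *)

Set Implicit Arguments.
Unset Strict Implicit.
Unset Printing Implicit Defensive.

Local Open Scope classical_set_scope.
Local Open Scope ring_scope.

(** * Distance to a set and Hausdorff distance *)

Section metric.
Context {R : realType} {X : pmetricType R}.
Implicit Types (A B : set X) (f : X -> R) (x y : X).

Definition lipschitz_cst (C : R) f :=
  forall x y, `|f x - f y| <= C * mdist x y.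

Lemma lipschitz_cst_continuous C f : lipschitz_cst C f -> continuous f.
Proof.
move=> fC x; apply/cvgrPdist_lt => e e0.
have C0 : 0 < `|C| + 1 by rewrite ltr_wpDl.
near=> y; apply: le_lt_trans (fC x y) _.
have : mdist x y < e / (`|C| + 1).
  near: y; apply/nbhs_ballP; exists (e / (`|C| + 1)) => /=; first by rewrite divr_gt0.
  by move=> z; rewrite ballEmdist.
rewrite ltr_pdivlMr// mulrC; apply: le_lt_trans.
by rewrite ler_wpM2r ?mdist_ge0// (le_trans (ler_norm C))// lerDl.
Unshelve. all: by end_near. Qed.

Lemma mdist_lipschitz x : lipschitz_cst 1 (mdist x).
Proof.
move=> y z; rewrite mul1r ler_distl; apply/andP; split.
  by rewrite lerBlDr metric_triangle.
by rewrite (metric_sym y z) metric_triangle.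
Qed.

Lemma mdist_bounded : compact [set: X] ->
  exists D : R, 0 < D /\ forall x y, mdist x y <= D.
Proof.
move=> cX; have := @compact_EVT_max X R (mdist point) setT.
case; [by exists point|by []|by apply: continuous_subspaceT; exact: lipschitz_cst_continuous (mdist_lipschitz _)|].
move=> c _ cmax; exists (mdist point c + mdist point c + 1).
rewrite ltr_pwDr ?addr_ge0 ?mdist_ge0//; split => // x y.
rewrite ler_wpDr// (le_trans (metric_triangle x point y))// lerD//.
  by rewrite metric_sym cmax// inE.
by rewrite cmax// inE.
Qed.

Definition infdist A x : R := inf [set mdist x y | y in A].

Lemma infdist_lbound A x : has_lbound [set mdist x y | y in A].
Proof. by exists 0 => _ [y Ay <-]; exact: mdist_ge0. Qed.

Lemma infdist_le A x y : A y -> infdist A x <= mdist x y.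
Proof. by move=> Ay; apply: ge_inf; [exact: infdist_lbound|exists y]. Qed.

Lemma le_infdist A x r : A !=set0 -> (forall y, A y -> r <= mdist x y) ->
  r <= infdist A x.
Proof.
move=> [y Ay] rA; apply: lb_le_inf; first by exists (mdist x y), y.
by move=> _ [z Az <-]; exact: rA.
Qed.

Lemma infdist_ge0 A x : A !=set0 -> 0 <= infdist A x.
Proof. by move=> A0; apply: le_infdist => // y _; exact: mdist_ge0. Qed.

Lemma infdist0 A x : A x -> infdist A x = 0.
Proof.
move=> Ax; apply/eqP; rewrite eq_le infdist_ge0 ?andbT; last by exists x.
by rewrite (le_trans (infdist_le _ Ax))// mdistxx.
Qed.

Lemma infdist_lipschitz A : A !=set0 -> lipschitz_cst 1 (infdist A).
Proof.
move=> A0 x y; wlog suff : x y / infdist A x <= infdist A y + mdist x y.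
  move=> H; rewrite mul1r ler_distl lerBlDr H/=.
  by rewrite -lerBlDr metric_sym lerBlDr H.
rewrite -lerBlDr; apply: le_infdist => // z Az.
by rewrite lerBlDl (le_trans (infdist_le x Az))// metric_triangle.
Qed.

Lemma infdist_gt0 A x : A !=set0 -> closed A -> ~ A x -> 0 < infdist A x.
Proof.
move=> A0 clA nAx.
have /nbhs_ballP[e /= e0 eA] : nbhs x (~` A).
  by apply: open_nbhs_nbhs; split => //; exact: closed_openC.
apply: lt_le_trans e0 _; apply: le_infdist => // y Ay.
by rewrite leNgt; apply/negP => xy; apply: (eA y) => //; rewrite ballEmdist.
Qed.

Lemma infdist_attained A x : compact A -> A !=set0 ->
  exists2 y, A y & mdist x y = infdist A x.
Proof.
move=> cA A0; have [//|//||y Ay ymin] := @compact_EVT_min X R (mdist x) A.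
  by apply: continuous_subspaceT; exact: lipschitz_cst_continuous (mdist_lipschitz _).
exists y; first by rewrite inE in Ay.
apply/eqP; rewrite eq_le infdist_le ?andbT; last by rewrite inE in Ay.
by apply: le_infdist => // z Az; apply: ymin; rewrite inE.
Qed.

Lemma hausdorff_distE A B : hausdorff_dist A B =
  Num.max (sup (infdist B @` A)) (sup (infdist A @` B)).
Proof.
rewrite /hausdorff_dist; congr (Num.max _ (sup _)).
apply/seteqP; split => _ [x Bx <-]; exists x => //; rewrite /infdist; congr inf;
  by apply/seteqP; split => _ [y Ay <-]; exists y => //; rewrite metric_sym.
Qed.

Definition within_dist (r : R) A B := forall x, A x -> exists2 y, B y & mdist x y <= r.

Lemma infdist_bounded A : compact A -> forall B, B !=set0 ->
  has_ubound (infdist B @` A).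
Proof.
move=> cA B B0; have [->|A0] := eqVneq A set0.
  by exists 0 => r [].
have := @compact_EVT_max X R (infdist B) A.
case; [exact/set0P|by []| |].
  by apply: continuous_subspaceT; exact: lipschitz_cst_continuous (infdist_lipschitz _).
move=> c _ cmax; exists (infdist B c) => _ [x Ax <-].
by apply: cmax; rewrite inE.
Qed.

(** On compact sets the infimum defining the distance to a set is attained, so the
inequality becomes a statement about points. *)
Lemma sup_infdist_le r A B : Kstar X A -> Kstar X B ->
  sup (infdist B @` A) <= r <-> within_dist r A B.
Proof.
move=> [cA A0] [cB B0]; split=> [h x Ax|h].
  have [y By xy] := infdist_attained x cB B0; exists y => //.
  rewrite xy (le_trans _ h)//; apply: ub_le_sup; last by exists x.
  exact: infdist_bounded.
apply: ge_sup; first by case: A0 => x Ax; exists (infdist B x), x.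
move=> _ [x Ax <-]; have [y By] := h _ Ax.
exact/le_trans/infdist_le.
Qed.

Lemma hausdorff_dist_le r A B : Kstar X A -> Kstar X B ->
  hausdorff_dist A B <= r <-> within_dist r A B /\ within_dist r B A.
Proof.
move=> KA KB; rewrite hausdorff_distE ge_max.
split=> [/andP[]|[AB BA]].
  by move=> /(sup_infdist_le _ KA KB) ? /(sup_infdist_le _ KB KA).
by apply/andP; split; apply/sup_infdist_le.
Qed.

Lemma hausdorff_dist_ge0 A B : Kstar X A -> Kstar X B -> 0 <= hausdorff_dist A B.
Proof.
move=> KA KB; have [_ [x Ax]] := KA.
have [h _] := (hausdorff_dist_le _ KA KB).1 (lexx _).
by have [y _] := h _ Ax; apply: le_trans; exact: mdist_ge0.
Qed.

Lemma hausdorff_dist_sym A B : hausdorff_dist A B = hausdorff_dist B A.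
Proof. by rewrite !hausdorff_distE maxC. Qed.

Lemma hausdorff_dist_triangle B A C : Kstar X A -> Kstar X B -> Kstar X C ->
  hausdorff_dist A C <= hausdorff_dist A B + hausdorff_dist B C.
Proof.
move=> KA KB KC; apply/(hausdorff_dist_le _ KA KC).
have [AB BA] := (hausdorff_dist_le _ KA KB).1 (lexx _).
have [BC CB] := (hausdorff_dist_le _ KB KC).1 (lexx _).
split=> x.
  move=> /AB[y /BC[z Cz yz] xy]; exists z => //.
  by rewrite (le_trans (metric_triangle x y z))// lerD.
move=> /CB[y /BA[z Cz yz] xy]; exists z => //.
by rewrite (le_trans (metric_triangle x y z))// addrC lerD.
Qed.

End metric.

(** * Integrals of bounded measurable functions against probabilities *)

Section bounded_measurable.
Context {R : realType} d (T : measurableType d).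
Implicit Types (f g : T -> R) (P : probability T R).

(** The class on which integrals against any probability are linear and monotone
with no further integrability condition; all the functions met below are in it. *)
Definition bounded_measurable f :=
  measurable_fun setT f /\ exists M, forall x, `|f x| <= M.

Lemma bounded_measurable_integrable P f : bounded_measurable f ->
  P.-integrable setT (EFin \o f).
Proof.
move=> [mf [M fM]]; apply: measurable_bounded_integrable => //.
  by rewrite (le_lt_trans (probability_le1 _ _))// ltry.
exists M; split; rewrite ?num_real// => y My x _ /=.
by rewrite (le_trans (fM x))// ltW.
Qed.

Lemma bounded_measurable_cst c : bounded_measurable (cst c).
Proof. by split; [exact: measurable_cst|exists `|c|]. Qed.

Lemma bounded_measurableD f g : bounded_measurable f -> bounded_measurable g ->
  bounded_measurable (fun x => f x + g x).
Proof.
move=> [mf [M fM]] [mg [N gN]]; split; first exact: measurable_funD.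
by exists (M + N) => x; rewrite (le_trans (ler_normD _ _))// lerD.
Qed.

Lemma bounded_measurableZ c f : bounded_measurable f ->
  bounded_measurable (fun x => c * f x).
Proof.
move=> [mf [M fM]]; split; first exact: measurable_funM.
by exists (`|c| * M) => x; rewrite normrM ler_wpM2l.
Qed.

Lemma bounded_measurable_sum (I : Type) (s : seq I) (F : I -> T -> R) :
  (forall i, bounded_measurable (F i)) ->
  bounded_measurable (fun x => \sum_(i <- s) F i x).
Proof.
move=> mF; elim: s => [|i s IH].
  by under eq_fun do rewrite big_nil; exact: bounded_measurable_cst.
by under eq_fun do rewrite big_cons; exact: bounded_measurableD.
Qed.

Lemma mean_cst P c : \int[P]_x c = c.
Proof.
rewrite Rintegral_cst//.
have -> : (P : {measure set T -> \bar R}) setT = 1%E by exact: probability_setT.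
by rewrite mulr1.
Qed.

Lemma meanD P f g : bounded_measurable f -> bounded_measurable g ->
  \int[P]_x (f x + g x) = \int[P]_x f x + \int[P]_x g x.
Proof. by move=> bf bg; rewrite RintegralD//; exact: bounded_measurable_integrable. Qed.

Lemma meanZ P c f : bounded_measurable f ->
  \int[P]_x (c * f x) = c * \int[P]_x f x.
Proof. by move=> bf; rewrite RintegralZl//; exact: bounded_measurable_integrable. Qed.

Lemma meanB P f g : bounded_measurable f -> bounded_measurable g ->
  \int[P]_x (f x - g x) = \int[P]_x f x - \int[P]_x g x.
Proof. by move=> bf bg; rewrite RintegralB//; exact: bounded_measurable_integrable. Qed.

Lemma mean_sum P (I : Type) (s : seq I) (F : I -> T -> R) :
  (forall i, bounded_measurable (F i)) ->
  \int[P]_x (\sum_(i <- s) F i x) = \sum_(i <- s) \int[P]_x F i x.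
Proof.
move=> mF; elim: s => [|i s IH].
  by under eq_Rintegral do rewrite big_nil; rewrite big_nil mean_cst.
under eq_Rintegral do rewrite big_cons.
by rewrite big_cons meanD ?IH//; exact: bounded_measurable_sum.
Qed.

Lemma mean_le P f g : bounded_measurable f -> bounded_measurable g ->
  (forall x, f x <= g x) -> \int[P]_x f x <= \int[P]_x g x.
Proof. by move=> bf bg fg; apply: le_Rintegral => //; exact: bounded_measurable_integrable. Qed.

Lemma bounded_measurable_indic (A : set T) : measurable A ->
  bounded_measurable (\1_A : T -> R).
Proof.
move=> mA; split; first exact: measurable_indic.
by exists 1 => x; rewrite indicE; case: (x \in A); rewrite ?normr1 ?normr0.
Qed.

Lemma mean_indic P (A : set T) : measurable A ->
  \int[P]_x (\1_A x : R) = fine (P A).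
Proof. by move=> mA; rewrite /Rintegral integral_indic// setIT. Qed.

Lemma mean_dist_le P f g c : bounded_measurable f -> bounded_measurable g ->
  (forall x, `|f x - g x| <= c) -> `|\int[P]_x f x - \int[P]_x g x| <= c.
Proof.
move=> bf bg fg; rewrite ler_distl; apply/andP; split.
  rewrite lerBlDr -[X in _ + X](mean_cst P) -meanD//.
    apply: mean_le => //.
      by apply: bounded_measurableD => //; exact: bounded_measurable_cst.
    by move=> x; have := fg x; rewrite ler_distlC addrC => /andP[_].
  exact: bounded_measurable_cst.
rewrite -[X in _ + X](mean_cst P) -meanD//.
  apply: mean_le => //.
    by apply: bounded_measurableD => //; exact: bounded_measurable_cst.
  by move=> x; have := fg x; rewrite ler_distl => /andP[_].
exact: bounded_measurable_cst.
Qed.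

Lemma mean_eq (P Q : probability T R) f :
  (forall A, measurable A -> P A = Q A) -> \int[P]_x f x = \int[Q]_x f x.
Proof.
move=> PQ; congr fine; apply: eq_measure_integral => A mA _; exact: PQ.
Qed.

(** Markov's inequality: [e] times the indicator of the level set is below [f]. *)
Lemma mean0_null P f : bounded_measurable f -> (forall x, 0 <= f x) ->
  \int[P]_x f x = 0 -> forall e, 0 < e -> P [set x | e <= f x] = 0%E.
Proof.
move=> bf f0 If e e0; set A := [set x | _].
have mA : measurable A.
  have -> : A = setT `&` f @^-1` `[e, +oo[%classic.
    by rewrite setTI; apply/seteqP; split => x /=; rewrite in_itv/= andbT.
  by apply: bf.1.
have: e * fine (P A) <= 0.
  rewrite -If -mean_indic// -meanZ; last exact: bounded_measurable_indic.
  apply: mean_le => //.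
    exact/bounded_measurableZ/bounded_measurable_indic.
  move=> x; rewrite indicE; case: (boolP (x \in A)); rewrite ?mulr0// mulr1.
  by rewrite inE.
rewrite pmulr_rle0// => PA0; have PAfin : P A \is a fin_num by exact: fin_num_measure.
by apply/eqP; rewrite eq_le measure_ge0 andbT -(fineK PAfin) lee_fin.
Qed.

End bounded_measurable.

Section pushforward.
Context {R : realType} d d' (T : measurableType d) (T' : measurableType d').

Lemma mean_distribution (P : probability T R) (h : {mfun T >-> T'}) (f : T' -> R) :
  bounded_measurable f ->
  \int[distribution P h]_y f y = \int[P]_x f (h x).
Proof.
move=> bf; rewrite /Rintegral; congr fine; rewrite integral_distribution//.
  by apply/measurable_EFinP; case: bf.
apply: (@bounded_measurable_integrable _ _ _ P (f \o h)).
case: bf => mf [M fM]; split; first exact: measurableT_comp.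
by exists M => x; exact: fM.
Qed.

Lemma bounded_measurable_section (f : T * T' -> R) x :
  bounded_measurable f -> bounded_measurable (fun y => f (x, y)).
Proof.
move=> [mf [M fM]]; split; last by exists M.
exact: (measurableT_comp mf (pair1_measurable x)).
Qed.

(** Fubini's theorem in the form used to peel off one factor at a time. *)
Lemma mean_prod (P : probability T R) (Q : probability T' R) (f : T * T' -> R) :
  bounded_measurable f ->
  bounded_measurable (fun x => \int[Q]_y f (x, y)) /\
  \int[(P \x Q)%E]_z f z = \int[P]_x \int[Q]_y f (x, y).
Proof.
move=> bf.
have iPQ : (P \x Q)%E.-integrable setT (EFin \o f).
  exact: bounded_measurable_integrable.
have FE x : fubini_F Q (EFin \o f) x = (\int[Q]_y f (x, y))%:E.
  rewrite /fubini_F /Rintegral fineK//.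
  by apply: integrable_fin_num => //; exact/bounded_measurable_integrable/bounded_measurable_section.
split.
  split.
    apply/measurable_EFinP; have := measurable_fubini_F iPQ.
    by rewrite (funext FE).
  case: (bf) => mf [M fM]; exists M => x.
  rewrite -[X in `|X|]subr0 -[X in _ - X](mean_cst Q).
  apply: mean_dist_le; [exact: bounded_measurable_section|exact: bounded_measurable_cst|].
  by move=> y; rewrite subr0.
rewrite /Rintegral; congr fine; rewrite -(integral12_prod_meas1 iPQ); apply: eq_integral => x _.
exact: FE.
Qed.

End pushforward.

Section borel_measurable.
Context {R : realType} {X : pmetricType R}.

Lemma continuous_borel_measurable (f : X -> R) : continuous f ->
  measurable_fun setT (f : borel X -> R).
Proof.
move=> /continuousP cf; apply: (measurability _ (RGenOpens.measurableE R)).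
move=> _ [_ [a [b ->] <-]]; rewrite setTI; apply: sub_sigma_algebra.
exact/cf/interval_open.
Qed.

Lemma continuous_bounded_measurable (f : X -> R) : compact [set: X] ->
  continuous f -> bounded_measurable (f : borel X -> R).
Proof.
move=> cX cf; split; first exact: continuous_borel_measurable.
have [||c _ cmax] := @compact_EVT_max X R (fun x => `|f x|) setT _ cX.
- by exists point.
- apply: continuous_subspaceT => x; apply: continuous_comp; first exact: cf.
  exact: norm_continuous.
- by exists `|f c| => x; apply: cmax; rewrite inE.
Qed.

End borel_measurable.

(** * Lipschitz test functions *)

Section lipschitz_functions.
Context {R : realType} {X : pmetricType R}.
Implicit Types (f g : X -> R) (U V : set X).

Definition lipf f := exists C, lipschitz_cst C f.

Lemma lipf_continuous f : lipf f -> continuous f.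
Proof. by move=> [C]; exact: lipschitz_cst_continuous. Qed.

Lemma lipschitz_cst_ge0 f C : lipschitz_cst C f -> lipschitz_cst `|C| f.
Proof.
by move=> fC x y; rewrite (le_trans (fC x y))// ler_wpM2r ?mdist_ge0// ler_norm.
Qed.

Lemma lipf_cst c : lipf (fun=> c).
Proof. by exists 0 => x y; rewrite subrr normr0 mul0r. Qed.

Lemma lipfD f g : lipf f -> lipf g -> lipf (fun x => f x + g x).
Proof.
move=> [C fC] [D gD]; exists (C + D) => x y.
by rewrite opprD addrACA mulrDl (le_trans (ler_normD _ _))// lerD.
Qed.

Lemma lipfZ c f : lipf f -> lipf (fun x => c * f x).
Proof.
move=> [C fC]; exists (`|c| * C) => x y.
by rewrite -mulrBr normrM -mulrA ler_wpM2l.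
Qed.

Lemma lipfN f : lipf f -> lipf (fun x => - f x).
Proof. by move=> /(lipfZ (-1)); under eq_fun do rewrite mulN1r. Qed.

Lemma lipfB f g : lipf f -> lipf g -> lipf (fun x => f x - g x).
Proof. by move=> lf /lipfN; exact: lipfD. Qed.

Lemma lipf_norm f : lipf f -> lipf (fun x => `|f x|).
Proof.
move=> [C fC]; exists C => x y; apply: le_trans (fC x y).
exact: ler_dist_dist.
Qed.

Lemma lipf_max f g : lipf f -> lipf g -> lipf (fun x => Num.max (f x) (g x)).
Proof.
move=> lf lg; rewrite (_ : (fun x => _) =
    (fun x => 2^-1 * (f x + g x + `|f x - g x|))); last first.
  by apply/funext => x; rewrite maxr_absE mulrC.
by apply/lipfZ/lipfD; [exact: lipfD|exact/lipf_norm/lipfB].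
Qed.

Lemma lipf_min f g : lipf f -> lipf g -> lipf (fun x => Num.min (f x) (g x)).
Proof.
move=> lf lg; rewrite (_ : (fun x => _) =
    (fun x => 2^-1 * (f x + g x - `|f x - g x|))); last first.
  by apply/funext => x; rewrite minr_absE mulrC.
by apply/lipfZ/lipfB; [exact: lipfD|exact/lipf_norm/lipfB].
Qed.

Lemma lipf_sum (I : Type) (s : seq I) (F : I -> X -> R) :
  (forall i, lipf (F i)) -> lipf (fun x => \sum_(i <- s) F i x).
Proof.
move=> lF; elim: s => [|i s IH].
  by under eq_fun do rewrite big_nil; exact: lipf_cst.
by under eq_fun do rewrite big_cons; exact: lipfD.
Qed.

Lemma lipf_bounded_measurable f : compact [set: X] -> lipf f ->
  bounded_measurable (f : borel X -> R).
Proof. by move=> cX /lipf_continuous; exact: continuous_bounded_measurable. Qed.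

(** Lipschitz test functions are enough to measure open sets from inside, and they
are the functions whose integrals a Monge-Kantorovich Cauchy sequence controls. *)
Definition below_indic U : set (X -> R) :=
  [set f | [/\ lipf f, forall x, 0 <= f x <= 1 & forall x, ~ U x -> f x = 0]].

Lemma below_indic0 U : below_indic U (fun=> 0).
Proof. by split=> // [|x]; [exact: lipf_cst|rewrite lexx ler01]. Qed.

(** The whole space is set apart because [infdist set0] is null. *)
Definition open_bump U (x : X) : R :=
  if pselect (~` U !=set0) then Num.min 1 (infdist (~` U) x) else 1.

Lemma open_bump_below U : below_indic U (open_bump U).
Proof.
rewrite /open_bump; case: pselect => [U0|U0]; split.
- by apply: lipf_min; [exact: lipf_cst|exists 1; exact: infdist_lipschitz].
- by move=> x; rewrite le_min ler01 infdist_ge0//= ge_min lexx.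
- by move=> x nUx; rewrite infdist0//; apply/min_idPr.
- exact: lipf_cst.
- by move=> x; rewrite ler01 lexx.
- by move=> x nUx; exfalso; apply: U0; exists x.
Qed.

Lemma open_bump_gt0 U x : open U -> U x -> 0 < open_bump U x.
Proof.
move=> oU Ux; rewrite /open_bump; case: pselect => // U0.
rewrite lt_min ltr01/=; apply: infdist_gt0 => //.
exact: open_closedC.
Qed.

End lipschitz_functions.

Lemma min1_sum {R : realType} (I : Type) (s : seq I) (t : I -> R) :
  (forall i, 0 <= t i) ->
  Num.min 1 (\sum_(i <- s) t i) <= \sum_(i <- s) Num.min 1 (t i).
Proof.
move=> t0; elim: s => [|i s IH]; first by rewrite !big_nil ge_min lexx orbT.
rewrite !big_cons; have := t0 i.
have : 0 <= \sum_(j <- s) t j by exact: sumr_ge0.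
move: IH; move: (\sum_(j <- s) t j) (\sum_(j <- s) Num.min 1 (t j)) (t i) => u v w.
by rewrite /Num.min; case: ifPn; case: ifPn; case: ifPn; lra.
Qed.

(** A Lebesgue-number argument: finitely many of the bumps have a sum that is
positive on [K], hence bounded below there by a positive number [c^-1]. *)
Lemma compact_subcover_bumps {R : realType} {X : pmetricType R}
    (K : set X) (U : nat -> set X) :
  compact K -> (forall n, open (U n)) -> K `<=` \bigcup_n U n ->
  exists N, exists2 c : R, 0 < c &
    forall x, K x -> 1 <= \sum_(i < N) Num.min 1 (c * open_bump (U i) x).
Proof.
move=> cK oU KU.
have [N HN] : exists N, forall x, K x -> 0 < \sum_(i < N) open_bump (U i) x.
  have cov : near_covering K by exact/compact_near_coveringP.
  have := cov nat \oo (fun N x => 0 < \sum_(i < N) open_bump (U i) x) _.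
  case=> [x Kx|N _ HN]; last by exists N => x Kx; exact: (HN N (leqnn N)).
  have [n _ Unx] := KU x Kx.
  exists (U n, [set N | (n < N)%N]); first split.
  - by apply: open_nbhs_nbhs; split => //; exact: oU.
  - by exists n.+1.
  - move=> [y N] [/= Uny nN]; rewrite (bigD1 (Ordinal nN))//=.
    rewrite ltr_pwDl//; first exact: open_bump_gt0.
    by apply: sumr_ge0 => i _; have [_ /(_ y)/andP[]] := open_bump_below (U i).
exists N; have [K0|K0] := pselect (K !=set0); last first.
  by exists 1 => // x Kx; exfalso; apply: K0; exists x.
pose s (x : X) : R := \sum_(i < N) open_bump (U i) x.
have ls : lipf s by apply: lipf_sum => i; have [] := open_bump_below (U i).
have [//|//||y] := @compact_EVT_min X R s K.
  exact/continuous_subspaceT/lipf_continuous.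
rewrite inE => Ky ymin; have sy := HN y Ky.
exists (s y)^-1; first by rewrite invr_gt0.
move=> x Kx; apply: le_trans (min1_sum _ _).
  by rewrite -mulr_sumr le_min lexx/= ler_pdivlMl// mulr1 ymin// inE.
move=> i; rewrite mulr_ge0//; first by rewrite invr_ge0 ltW.
by have [_ /(_ x)/andP[]] := open_bump_below (U i).
Qed.

(** * The measure of a positive functional *)

Section riesz.
Context {R : realType} {X : pmetricType R}.
Implicit Types (f g : X -> R) (U V : set X).

(** Nothing is asked outside the Lipschitz functions: the functionals of interest
are limits of integrals, which are only known to exist for those functions. *)
Definition positive_functional (L : (X -> R) -> R) :=
  [/\ forall f g, lipf f -> lipf g -> L (fun x => f x + g x) = L f + L g,
      forall c f, lipf f -> L (fun x => c * f x) = c * L f,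
      forall f g, lipf f -> lipf g -> (forall x, f x <= g x) -> L f <= L g
    & L (fun=> 1) = 1].

Section functional.
Context (L : (X -> R) -> R) (pL : positive_functional L).

Lemma functional_cst c : L (fun=> c) = c.
Proof.
have [_ LZ _ L1] := pL; have := LZ c (fun=> 1) (lipf_cst 1).
by rewrite L1 mulr1 => Lc; rewrite -[RHS]Lc; congr L; apply/funext => x; rewrite mulr1.
Qed.

Lemma functionalB f g : lipf f -> lipf g -> L (fun x => f x - g x) = L f - L g.
Proof.
have [LD LZ _ _] := pL => lf lg; rewrite LD//; last exact: lipfN.
congr (_ + _); rewrite -mulN1r -LZ//.
by congr L; apply/funext => x; rewrite mulN1r.
Qed.

Lemma functional_sum (I : Type) (s : seq I) (F : I -> X -> R) :
  (forall i, lipf (F i)) -> L (fun x => \sum_(i <- s) F i x) = \sum_(i <- s) L (F i).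
Proof.
have [LD _ _ _] := pL => lF; elim: s => [|i s IH].
  by under eq_fun do rewrite big_nil; rewrite big_nil functional_cst.
under eq_fun do rewrite big_cons.
by rewrite big_cons LD ?IH//; exact: lipf_sum.
Qed.

Definition open_content U : R := sup (L @` below_indic U).

Let below01 U f : below_indic U f -> 0 <= L f <= 1.
Proof.
have [_ _ Lle _] := pL => -[lf f01 _].
rewrite -(functional_cst 0) -(functional_cst 1).
by rewrite !Lle//; try exact: lipf_cst; move=> x; have /andP[] := f01 x.
Qed.

Lemma le_open_content U f : below_indic U f -> L f <= open_content U.
Proof.
move=> Uf; apply: ub_le_sup; last by exists f.
by exists 1 => _ [g Ug <-]; have /andP[] := below01 Ug.
Qed.

Lemma open_content_le U r : (forall f, below_indic U f -> L f <= r) ->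
  open_content U <= r.
Proof.
move=> Ur; apply: ge_sup; first by exists (L (fun=> 0)), (fun=> 0) => //; exact: below_indic0.
by move=> _ [f Uf <-]; exact: Ur.
Qed.

Lemma open_content_ge0 U : 0 <= open_content U.
Proof.
by rewrite -[leLHS](functional_cst 0) le_open_content//; exact: below_indic0.
Qed.

Lemma open_contentS U V : U `<=` V -> open_content U <= open_content V.
Proof.
move=> UV; apply: open_content_le => f [lf f01 fU]; apply: le_open_content; split => //.
by move=> x nVx; apply: fU => Ux; exact/nVx/UV.
Qed.

Lemma open_content0 : open_content set0 = 0.
Proof.
apply/eqP; rewrite eq_le open_content_ge0 andbT.
apply: open_content_le => f [_ _ f0].
by rewrite (_ : f = fun=> 0) ?functional_cst//; apply/funext => x; rewrite f0.
Qed.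

Lemma open_contentT : open_content setT = 1.
Proof.
apply/eqP; rewrite eq_le; apply/andP; split.
  by apply: open_content_le => f /below01/andP[].
rewrite -[leLHS](functional_cst 1) le_open_content//; split => //.
- exact: lipf_cst.
- by move=> x; rewrite lexx ler01.
- by move=> x /(_ I).
Qed.

Context (cX : compact [set: X]).

(** Where [f] is below [e] the term [e] is enough; the rest of the space is compact,
and finitely many of the [U i] cover it with bumps summing to at least [1]. *)
Lemma open_content_subadditive (U : nat -> set X) f e :
  (forall n, open (U n)) -> below_indic (\bigcup_n U n) f -> 0 < e ->
  exists N, L f <= e + \sum_(i < N) open_content (U i).
Proof.
move=> oU [lf f01 f0] e0.
have [LD _ Lle _] := pL.
have cK : compact [set x | e <= f x].
  apply: subclosed_compact cX _ => //.
  rewrite (_ : [set x | _] = f @^-1` [set r | e <= r])//.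
  by apply: (preimage_closed _ (@closed_ge _ e)) => x _; exact: lipf_continuous.
have [|N [c c0 Hc]] := @compact_subcover_bumps _ _ [set x | e <= f x] U cK oU.
  move=> x /= ex; apply: contrapT => /f0 fx0.
  by move: ex; rewrite fx0 leNgt e0.
have bU i : below_indic (U i) (fun x => Num.min 1 (c * open_bump (U i) x)).
  have [lb b01 b0] := open_bump_below (U i).
  split; first by apply: lipf_min; [exact: lipf_cst|exact: lipfZ].
  - move=> x; rewrite le_min ler01 ge_min lexx/= andbT mulr_ge0 ?(ltW c0)//.
    by have /andP[] := b01 x.
  - by move=> x /b0 ->; rewrite mulr0; apply/min_idPr.
exists N; apply: (@le_trans _ _ (L (fun x => e + \sum_(i < N) Num.min 1 (c * open_bump (U i) x)))).
  apply: Lle => //.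
    by apply: lipfD; [exact: lipf_cst|apply: lipf_sum => i; have [] := bU i].
  move=> x; have [ex|/ltW ex] := leP e (f x); last first.
    rewrite (le_trans ex)// lerDl sumr_ge0// => i _.
    by have [_ /(_ x)/andP[]] := bU i.
  have /andP[_ fx1] := f01 x.
  by rewrite (le_trans fx1)// (le_trans (Hc x ex))// lerDr ltW.
rewrite LD; [|exact: lipf_cst|by apply: lipf_sum => i; have [] := bU i].
rewrite functional_cst lerD2l functional_sum; last by move=> i; have [] := bU i.
by apply: ler_sum => i _; exact: le_open_content.
Qed.

End functional.
End riesz.

Section riesz_measure.
Context {R : realType} {X : pmetricType R}.
Context (L : (X -> R) -> R) (pL : positive_functional L) (cX : compact [set: X]).
Implicit Types (A : set X).

Definition open_supersets A : set (set X) := [set U | open U /\ A `<=` U].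

Definition riesz_outer_real A : R := inf (open_content L @` open_supersets A).

Let riesz_outer_lbound A : has_lbound (open_content L @` open_supersets A).
Proof. by exists 0 => _ [U _ <-]; exact: open_content_ge0. Qed.

Let open_supersetsT A : open_supersets A setT.
Proof. by split => //; exact: openT. Qed.

Lemma riesz_outer_le A U : open U -> A `<=` U -> riesz_outer_real A <= open_content L U.
Proof. by move=> oU AU; apply: ge_inf => //; exists U. Qed.

Lemma le_riesz_outer A r : (forall U, open U -> A `<=` U -> r <= open_content L U) ->
  r <= riesz_outer_real A.
Proof.
move=> Ar; apply: lb_le_inf; first by exists (open_content L setT), setT.
by move=> _ [U [oU AU] <-]; exact: Ar.
Qed.

Lemma riesz_outer_open U : open U -> riesz_outer_real U = open_content L U.
Proof.
move=> oU; apply/eqP; rewrite eq_le riesz_outer_le//=.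
by apply: le_riesz_outer => V oV; exact: open_contentS.
Qed.

Lemma riesz_outer_ge0 A : 0 <= riesz_outer_real A.
Proof. by apply: le_riesz_outer => U _ _; exact: open_content_ge0. Qed.

(** The functional and its properties are arguments so that the outer measure
structure below can be inferred. *)
Definition riesz_outer of positive_functional L & compact [set: X] :
  set X -> \bar R := fun A => (riesz_outer_real A)%:E.

Local Open Scope ereal_scope.

Let mu := riesz_outer pL cX.

Let mu0 : mu set0 = 0.
Proof.
rewrite /mu /riesz_outer riesz_outer_open ?open_content0//; exact: open0.
Qed.

Let mu_ge0 A : 0 <= mu A.
Proof. by rewrite lee_fin riesz_outer_ge0. Qed.

Let mu_le : {homo mu : A B / A `<=` B >-> A <= B}.
Proof.
move=> A B AB; rewrite lee_fin; apply: le_riesz_outer => U oU BU.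
by apply: riesz_outer_le => //; exact: subset_trans BU.
Qed.

Let mu_subadditive : sigma_subadditive mu.
Proof.
move=> F; apply/lee_addgt0Pr => e e0.
apply: le_trans (epsilon_trick xpredT (fun n => mu_ge0 (F n)) (ltW e0)).
have HU n : exists U, [/\ open U, F n `<=` U &
    (open_content L U <= riesz_outer_real (F n) + e / (2 ^ n.+1)%:R)%R].
  have en0 : (0 < e / (2 ^ n.+1)%:R)%R by rewrite divr_gt0// ltr0n expn_gt0.
  have [|_ [U [oU FU] <-] lt] := @inf_adherent R (open_content L @` open_supersets (F n)) _ en0.
    by split => //; exists (open_content L setT), setT.
  by exists U; split => //; exact: ltW.
have [U HU'] := choice HU.
have oU : open (\bigcup_n U n) by apply: bigcup_open => n _; have [] := HU' n.
apply: (@le_trans _ _ (open_content L (\bigcup_n U n))%:E).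
  rewrite lee_fin; apply: riesz_outer_le => // x [n _ Fx]; exists n => //.
  by have [_ FnU _] := HU' n; exact: FnU.
apply: (@le_trans _ _ (\sum_(i <oo) (open_content L (U i))%:E)); last first.
  apply: lee_nneseries => [n _ _|n _]; first by rewrite lee_fin open_content_ge0.
  by rewrite -EFinD lee_fin; have [] := HU' n.
have sN N : \sum_(0 <= i < N) (open_content L (U i))%:E <=
    \sum_(i <oo) (open_content L (U i))%:E.
  by apply: nneseries_lim_ge => n _ _; rewrite lee_fin open_content_ge0.
case: (\sum_(i <oo) _) sN => [s sN|_|sN].
- rewrite lee_fin; apply: open_content_le => // h hU.
  apply/ler_addgt0Pr => e' e'0.
  have [|N LN] := open_content_subadditive pL cX _ hU e'0.
    by move=> n; have [] := HU' n.
  rewrite (le_trans LN)// addrC lerD2r -lee_fin.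
  by have := sN N; rewrite big_mkord sumEFin.
- exact: leey.
- by have := sN 0%N; rewrite big_geq.
Qed.

HB.instance Definition _ := isOuterMeasure.Build R X (riesz_outer pL cX)
  mu0 mu_ge0 mu_le mu_subadditive.

(** It suffices to split open sets [V]. A test function [f] of [V `&` U], lowered by
[e] and cut at zero, vanishes on [V `&` [set x | f x < e]], an open set containing [V `\` U]; so it
can be added to a test function of the latter set to give a test function of [V]. *)
Lemma riesz_open_caratheodory (U : set X) : open U ->
  (riesz_outer pL cX).-caratheodory U.
Proof.
move=> oU; apply: le_caratheodory_measurable => A /=.
rewrite -EFinD lee_fin; apply: le_riesz_outer => V oV AV.
have oVU : open (V `&` U) by exact: openI.
apply: (@le_trans _ _ (open_content L (V `&` U) + riesz_outer_real (V `&` ~` U)))%R.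
  apply: lerD; first by apply: riesz_outer_le => // x [/AV].
  by rewrite -lee_fin; apply: mu_le => x [/AV].
rewrite -lerBrDr; apply: open_content_le => // f [lf f01 f0].
rewrite lerBrDr; apply/ler_addgt0Pr => e e0.
pose W := V `&` [set x | (f x < e)%R].
have oW : open W.
  apply: openI => //; rewrite (_ : [set x | _] = f @^-1` [set r | (r < e)%R])//.
  by apply: (open_comp _ (@open_lt _ e)) => x _; exact: lipf_continuous.
apply: (@le_trans _ _ (L f + open_content L W))%R.
  rewrite lerD2l; apply: riesz_outer_le => // x [Vx nUx]; split => //=.
  by rewrite f0// => -[].
rewrite -lerBrDl; apply: open_content_le => // g [lg g01 g0].
rewrite lerBrDl -lerBlDr addrAC.
have [LD _ Lle _] := pL.
have lfe : lipf (fun x => f x - e)%R by apply: lipfB => //; exact: lipf_cst.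
have lm : lipf (fun x => Num.max (f x - e) 0)%R.
  by apply: lipf_max => //; exact: lipf_cst.
apply: (@le_trans _ _ (L (fun x => Num.max (f x - e) 0 + g x)%R)).
  rewrite LD// lerD2r -[X in (_ - X <= _)%R](functional_cst pL) -functionalB//; last exact: lipf_cst.
  by apply: Lle => // x; rewrite le_max lexx.
apply: le_open_content => //; split; first exact: lipfD.
- move=> x; have /andP[fx0 fx1] := f01 x; have /andP[gx0 gx1] := g01 x.
  rewrite addr_ge0//=; last by rewrite le_max lexx orbT.
  have [fe|fe] := ltP (f x) e.
    by rewrite (max_idPr _) ?add0r// subr_le0 ltW.
  rewrite (g0 x) ?addr0; first by rewrite ge_max ler01 andbT lerBlDr ler_wpDr// ltW.
  by move=> [_ /=]; rewrite ltNge fe.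
- move=> x nVx; rewrite f0; last by case.
  rewrite g0 ?addr0; last by case.
  by apply/max_idPr; rewrite sub0r oppr_le0 ltW.
Qed.

Definition riesz_measure of positive_functional L & compact [set: X] :
  set (borel X) -> \bar R := fun A => (riesz_outer_real A)%:E.

Let nu := riesz_measure pL cX.

Let nu_sigma_additive : semi_sigma_additive nu.
Proof.
have bc (A : set (borel X)) : measurable A -> (riesz_outer pL cX).-caratheodory A.
  move: A; apply: smallest_sub; last exact: riesz_open_caratheodory.
  exact: (@sigma_algebra_measurable _ (caratheodory_type (riesz_outer pL cX))).
move=> F mF tF mUF.
apply: (@caratheodory_measure_sigma_additive R X (riesz_outer pL cX) F) => //.
  by move=> n; exact: bc.
exact: bc.
Qed.

HB.instance Definition _ := isMeasure.Build _ _ _ (riesz_measure pL cX)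
  mu0 mu_ge0 nu_sigma_additive.

Let nuT : nu setT = 1.
Proof.
rewrite /nu /riesz_measure riesz_outer_open ?open_contentT//; exact: openT.
Qed.

HB.instance Definition _ := Measure_isProbability.Build _ _ _ (riesz_measure pL cX) nuT.

Lemma riesz_measure_open (U : set X) : open U ->
  riesz_measure pL cX U = (open_content L U)%:E.
Proof. by move=> oU; rewrite /riesz_measure riesz_outer_open. Qed.

End riesz_measure.

(** * The Riesz-Markov theorem *)

Section riesz_representation.
Context {R : realType} {X : pmetricType R}.
Context (L : (X -> R) -> R) (pL : positive_functional L) (cX : compact [set: X]).
Implicit Types (f : X -> R).

Let mu : probability (borel X) R := riesz_measure pL cX.

(** Layer cake: with [c k] the truncation of [f] at height [k * d], the slice
[c k.+2 - c k.+1] lies under [d] times the indicator of [f > k.+1 * d], itself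
under the slice [c k.+1 - c k]. *)
Lemma functional_truncation_le f d k : lipf f -> (forall x, 0 <= f x) -> 0 < d ->
  L (fun x => Num.min (f x) (k.+1%:R * d)) <=
  d + \int[mu]_x Num.min (f x) (k%:R * d).
Proof.
move=> lf f0 d0; have [LD LZ Lle _] := pL.
have lc j : lipf (fun x => Num.min (f x) (j%:R * d)).
  by apply: lipf_min => //; exact: lipf_cst.
elim: k => [|k IH].
  apply: (@le_trans _ _ (d + 0)).
    rewrite addr0 -[leRHS](functional_cst pL); apply: Lle => //; first exact: lipf_cst.
    by move=> x; rewrite mul1r ge_min lexx orbT.
  rewrite lerD2l; apply: Rintegral_ge0 => x _.
  by rewrite mul0r le_min f0 lexx.
pose U := [set x | k.+1%:R * d < f x].
have oU : open U.
  rewrite /U (_ : [set x | _] = f @^-1` [set r | k.+1%:R * d < r])//.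
  by apply: (open_comp _ (@open_gt _ (k.+1%:R * d))) => x _; exact: lipf_continuous.
(* The slices have height between [0] and [d]. *)
have slice j x : 0 <= Num.min (f x) (j.+1%:R * d) - Num.min (f x) (j%:R * d) <= d.
  rewrite -natr1 mulrDl mul1r; move: (j%:R * d) (f x) d0 => a b; clear.
  by move=> d0; rewrite /Num.min; case: ifPn; case: ifPn; lra.
rewrite (_ : (fun x => Num.min (f x) (k.+2%:R * d)) = (fun x =>
  Num.min (f x) (k.+1%:R * d) +
  (Num.min (f x) (k.+2%:R * d) - Num.min (f x) (k.+1%:R * d)))); last first.
  by apply/funext => x; rewrite addrC subrK.
rewrite LD//; last exact: lipfB.
apply: le_trans (lerD IH (lexx _)) _; rewrite -addrA lerD2l -lerBrDl.
have blc j := lipf_bounded_measurable cX (lc j).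
rewrite -meanB//.
apply: (@le_trans _ _ (d * open_content L U)).
  rewrite -ler_pdivrMl// -LZ; last exact: lipfB.
  apply: le_open_content => //; split; first exact/lipfZ/lipfB.
  - move=> x; have /andP[s0 sd] := slice k.+1 x.
    by rewrite mulr_ge0 ?invr_ge0 ?(ltW d0)//= ler_pdivrMl// mulr1.
  - move=> x /negP; rewrite -leNgt => fx; rewrite !(min_idPl _) ?subrr ?mulr0//.
    by rewrite (le_trans fx)// ler_wpM2r ?(ltW d0)// ler_nat.
have mU : measurable (U : set (borel X)) by exact: sub_sigma_algebra.
rewrite -[open_content L U]/(fine (open_content L U)%:E) -(riesz_measure_open pL cX oU).
rewrite -(mean_indic mu mU) -meanZ; last exact: bounded_measurable_indic.
apply: mean_le => //.
- exact/bounded_measurableZ/bounded_measurable_indic.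
- rewrite (_ : (fun x => _ - _) = (fun x => Num.min (f x) (k.+1%:R * d) +
    (-1) * Num.min (f x) (k%:R * d))); last by apply/funext => x; rewrite mulN1r.
  by apply: bounded_measurableD => //; exact: bounded_measurableZ.
- move=> x; rewrite indicE; case: (boolP (x \in U)) => [|_].
    rewrite inE /U/= => fx; rewrite mulr1 !(min_idPr _) ?(ltW fx)//.
      by rewrite -natr1 mulrDl mul1r addrAC subrr add0r.
    by rewrite (le_trans _ (ltW fx))// ler_wpM2r ?(ltW d0)// ler_nat.
  by rewrite mulr0; have /andP[] := slice k x.
Qed.

Let functional_le01 f : lipf f -> (forall x, 0 <= f x <= 1) ->
  L f <= \int[mu]_x f x.
Proof.
move=> lf f01; apply/ler_addgt0Pr => e e0.
have f0 x : 0 <= f x by have /andP[] := f01 x.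
have f1 x : f x <= 1 by have /andP[] := f01 x.
pose N := (Num.truncn e^-1).+1.
have N0 : 0 < N%:R :> R by rewrite ltr0n.
have Ne : N%:R^-1 <= e.
  rewrite -[leRHS]invrK lef_pV2 ?posrE ?invr_gt0//.
  by rewrite ltW// truncnS_gt.
have := functional_truncation_le N lf f0 (_ : 0 < N%:R^-1).
rewrite invr_gt0 => /(_ N0).
rewrite (_ : (fun x => Num.min _ (N.+1%:R / _)) = f); last first.
  apply/funext => x; apply/min_idPl; rewrite (le_trans (f1 x))//.
  by rewrite ler_pdivlMr// mul1r ler_nat.
move=> /le_trans; apply; rewrite addrC lerD//.
apply: mean_le => //; last by move=> x; rewrite ge_min lexx.
  by apply: lipf_bounded_measurable => //; apply: lipf_min => //; exact: lipf_cst.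
exact: lipf_bounded_measurable.
Qed.

Let functional_le f : lipf f -> L f <= \int[mu]_x f x.
Proof.
move=> lf; have [_ [M fM]] := lipf_bounded_measurable cX lf.
have [LD LZ _ _] := pL.
have M0 : 0 <= M by rewrite (le_trans _ (fM point)).
have M1 : 0 < M + 1 by rewrite ltr_wpDl.
(* An affine image of [f] with values between [0] and [1]. *)
pose g x := (M + 1 + f x) / (2 * (M + 1)).
have lg0 : lipf (fun x => M + 1 + f x) by apply: lipfD => //; exact: lipf_cst.
have gE : g = (fun x => (2 * (M + 1))^-1 * (M + 1 + f x)).
  by apply/funext => x; rewrite /g mulrC.
have lg : lipf g by rewrite gE; exact: lipfZ.
have: L g <= \int[mu]_x g x.
  apply: functional_le01 => // x; have := fM x; rewrite ler_norml => /andP[f1 f2].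
  by rewrite divr_ge0/= ?ler_pdivrMr; lra.
rewrite gE LZ// meanZ; last exact: lipf_bounded_measurable.
rewrite ler_pM2l ?invr_gt0 ?mulr_gt0// LD//; last exact: lipf_cst.
rewrite meanD; [|exact: bounded_measurable_cst|exact: lipf_bounded_measurable].
by rewrite functional_cst// mean_cst lerD2l.
Qed.

(** The Riesz-Markov theorem on a compact metric space: one inequality holds for all
Lipschitz functions, and applied to [-f] it gives the other. *)
Lemma riesz_representation f : lipf f -> \int[mu]_x f x = L f.
Proof.
move=> lf; apply/eqP; rewrite eq_le functional_le// andbT.
have [_ LZ _ _] := pL.
have := functional_le (lipfN lf).
under eq_Rintegral do rewrite -mulN1r.
rewrite (_ : (fun x => - f x) = (fun x => -1 * f x)); last first.
  by apply/funext => x; rewrite mulN1r.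
rewrite LZ// meanZ; last exact: lipf_bounded_measurable.
by rewrite !mulN1r lerN2.
Qed.

End riesz_representation.

(** * The Monge-Kantorovich distance *)

Section monge_kantorovich.
Context {R : realType} {X : pmetricType R} (cX : compact [set: X]).
Implicit Types (f : X -> R) (mu nu : probability (borel X) R).

Lemma lip1P f : lip1 f <-> lipschitz_cst 1 f.
Proof. by split=> h x y; have := h x y; rewrite mul1r. Qed.

Lemma lip1_lipf f : lip1 f -> lipf f.
Proof. by move=> /lip1P; exists 1. Qed.

Lemma dMK_bounded : exists2 D : R, 0 <= D & forall mu nu f, lip1 f ->
  `|\int[mu]_x f x - \int[nu]_x f x| <= D.
Proof.
have [D [D0 dD]] := mdist_bounded cX; exists (D + D) => [|mu nu f f1].
  by rewrite addr_ge0// ltW.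
have H (P : probability (borel X) R) : `|\int[P]_x f x - f point| <= D.
  rewrite -[X in _ - X](mean_cst P); apply: mean_dist_le.
  - exact/lipf_bounded_measurable/lip1_lipf.
  - exact: bounded_measurable_cst.
  - by move=> x; rewrite (le_trans (f1 _ _)).
by rewrite (le_trans (ler_distD (f point) _ _))// lerD// distrC.
Qed.

Lemma le_dMK mu nu f : lip1 f ->
  `|\int[mu]_x f x - \int[nu]_x f x| <= dMK mu nu.
Proof.
move=> f1; have [D _ HD] := dMK_bounded.
apply: ub_le_sup; last by exists f.
by exists D => _ [g g1 <-]; exact: HD.
Qed.

Lemma dMK_le mu nu r : (forall f, lip1 f ->
  `|\int[mu]_x f x - \int[nu]_x f x| <= r) -> dMK mu nu <= r.
Proof.
move=> H; apply: ge_sup; last by move=> _ [f f1 <-]; exact: H.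
exists `|\int[mu]_x 0 - \int[nu]_x 0|, (fun=> 0) => //.
by move=> x y; rewrite subrr normr0 mdist_ge0.
Qed.

Lemma dMK_ge0 mu nu : 0 <= dMK mu nu.
Proof.
apply: le_trans (@le_dMK _ _ (fun=> 0) _); first exact: normr_ge0.
by move=> x y; rewrite subrr normr0 mdist_ge0.
Qed.

Lemma dMKC mu nu : dMK mu nu = dMK nu mu.
Proof.
by apply/eqP; rewrite eq_le; apply/andP; split; apply: dMK_le => f f1;
  rewrite distrC; exact: le_dMK.
Qed.

Lemma dMK_triangle nu mu rho : dMK mu rho <= dMK mu nu + dMK nu rho.
Proof.
apply: dMK_le => f f1; rewrite (le_trans (ler_distD (\int[nu]_x f x) _ _))//.
by rewrite lerD// le_dMK.
Qed.

Lemma le_dMK_lipschitz C f mu nu : 0 <= C -> lipschitz_cst C f ->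
  `|\int[mu]_x f x - \int[nu]_x f x| <= C * dMK mu nu.
Proof.
rewrite le_eqVlt => /predU1P[<- f0|C0 fC].
  rewrite (_ : f = fun=> f point) ?mean_cst ?subrr ?normr0 ?mul0r//.
  apply/funext => x; apply/eqP; rewrite -subr_eq0 -normr_le0.
  by have := f0 x point; rewrite mul0r.
have bf : bounded_measurable (f : borel X -> R).
  by apply: lipf_bounded_measurable => //; exists C.
have g1 : lip1 (fun x => C^-1 * f x).
  by move=> x y; rewrite -mulrBr normrM gtr0_norm ?invr_gt0// ler_pdivrMl.
have := le_dMK mu nu g1; rewrite !meanZ// -mulrBr normrM gtr0_norm ?invr_gt0//.
by rewrite ler_pdivrMl.
Qed.

Lemma dMK_eq0_lipf mu nu f : dMK mu nu = 0 -> lipf f ->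
  \int[mu]_x f x = \int[nu]_x f x.
Proof.
move=> d0 [C /lipschitz_cst_ge0 fC]; apply/eqP.
by rewrite -subr_eq0 -normr_le0 (le_trans (le_dMK_lipschitz _ _ _ fC))// d0 mulr0.
Qed.

(** The truncated multiples of the bump increase to the indicator of [U], so that the
integrals of Lipschitz functions determine the measure of open sets. *)
Lemma open_bump_cvg (U : set X) mu : open U ->
  (\int[mu]_x Num.min 1 (k%:R * open_bump U x)) @[k --> \oo] --> fine (mu U).
Proof.
move=> oU; have [lb b01 b0] := open_bump_below U.
have mU : measurable (U : set (borel X)) by exact: sub_sigma_algebra.
rewrite -(mean_indic mu mU).
pose h k (x : borel X) : R := Num.min 1 (k%:R * open_bump U x).
have bh k : bounded_measurable (h k).
  by apply: lipf_bounded_measurable => //; apply: lipf_min; [exact: lipf_cst|exact: lipfZ].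
have h01 k x : 0 <= h k x <= 1.
  rewrite /h le_min ler01 ge_min lexx/= andbT mulr_ge0//.
  by have /andP[] := b01 x.
have [|||||_ _] := @dominated_convergence _ (borel X) R mu setT measurableT
  (fun k => EFin \o h k) (EFin \o \1_U) (EFin \o cst 1).
- by move=> k; apply/measurable_EFinP; case: (bh k).
- by apply/measurable_EFinP; exact: measurable_indic.
- apply: aeW => x _; apply: cvg_near_cst; have [Ux|nUx] := pselect (U x).
    have c0 : 0 < open_bump U x by exact: open_bump_gt0.
    exists (Num.truncn (open_bump U x)^-1).+1 => // k /= kc.
    rewrite indicE mem_set//= /h (min_idPl _)// -ler_pdivrMr// mul1r.
    by rewrite (le_trans (ltW (truncnS_gt _)))// ler_nat.
  by near=> k; rewrite /= indicE memNset// /h b0// mulr0 (min_idPr _).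
- refine (bounded_measurable_integrable mu (f:=cst 1) _). exact: bounded_measurable_cst.
- apply: aeW => x k _ /=; rewrite lee_fin; have /andP[h0 h1] := h01 k x.
  by rewrite ger0_norm.
move=> cv; rewrite /Rintegral.
have : (fine \o (fun k => \int[mu]_x (h k x)%:E))%E k @[k --> \oo] -->
    fine (\int[mu]_x (\1_U x)%:E).
  apply: fine_cvg; rewrite fineK//.
  apply: integrable_fin_num => //; apply: bounded_measurable_integrable.
  exact: bounded_measurable_indic.
exact.
Unshelve. all: by end_near. Qed.

(** Open sets are stable under intersection and generate the Borel sets. *)
Lemma dMK_eq0_borel mu nu (A : set (borel X)) : dMK mu nu = 0 -> measurable A ->
  mu A = nu A.
Proof.
move=> d0; apply: (@g_sigma_algebra_measure_unique _ R (borel X) (@open X)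
   _ (fun=> setT)).
- by move=> U oU; exact: sub_sigma_algebra.
- by move=> _; exact: openT.
- by rewrite bigcup_const//; exists 0%N.
- by move=> U V; exact: openI.
- move=> U oU.
  have mU : measurable (U : set (borel X)) by exact: sub_sigma_algebra.
  rewrite -[LHS]fineK ?fin_num_measure// -[RHS]fineK ?fin_num_measure//; congr EFin.
  have E : (fun k : nat => \int[mu]_x Num.min 1 (k%:R * open_bump U x)) =
           (fun k : nat => \int[nu]_x Num.min 1 (k%:R * open_bump U x)).
    apply/funext => k; apply: dMK_eq0_lipf => //.
    have [lb _ _] := open_bump_below U.
    by apply: lipf_min; [exact: lipf_cst|exact: lipfZ].
  have := @open_bump_cvg U mu oU; rewrite E => cm.
  exact: (cvg_unique (@Rhausdorff R) cm (@open_bump_cvg U nu oU)).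
- by move=> _; rewrite (le_lt_trans (probability_le1 _ _))// ltry.
Qed.

Lemma expr_small (c M e : R) : 0 <= c < 1 -> 0 < e -> exists k, M * c ^+ k < e.
Proof.
move=> /andP[c0 c1] e0.
have cv : geometric M c k @[k --> \oo] --> (0 : R).
  by apply: cvg_geometric; rewrite ger0_norm.
have /cvgrPdist_lt/(_ e e0)[k _ /(_ k (leqnn k))] := cv.
rewrite sub0r normrN => Hk; exists k; exact: le_lt_trans (ler_norm _) Hk.
Qed.

(** Along the Picard iteration the integrals of a Lipschitz function form a Cauchy
sequence. The limits define a positive functional, and the measure representing it
is the limit of the iteration. The fixed point is stated up to distance zero
because probabilities at distance zero may differ on sets that are not Borel. *)
Lemma dMK_contraction_fixpoint (Phi : probability (borel X) R -> probability (borel X) R)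
    (c : R) : 0 <= c < 1 ->
  (forall mu nu, dMK (Phi mu) (Phi nu) <= c * dMK mu nu) ->
  exists mu, dMK (Phi mu) mu = 0.
Proof.
move=> c01 cPhi; have /andP[c0 c1] := c01.
have [D D0 HD] := dMK_bounded.
have dD mu nu : dMK mu nu <= D by apply: dMK_le => f; exact: HD.
pose m k := iter k Phi (\d_(point : borel X) : probability _ _).
(* Contracting [k] times the distance from the first iterate to any other, which the
   diameter bounds, avoids summing a geometric series. *)
have mD k n : dMK (m k) (m (k + n)%N) <= D * c ^+ k.
  elim: k => [|k IH]; first by rewrite expr0 mulr1.
  rewrite addSn /m !iterS (le_trans (cPhi _ _))// exprS mulrCA.
  by rewrite ler_wpM2l.
pose u f k : R := \int[m k]_x f x.
have uD C f k n : 0 <= C -> lipschitz_cst C f ->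
    `|u f k - u f (k + n)%N| <= C * D * c ^+ k.
  move=> C0 fC; rewrite (le_trans (le_dMK_lipschitz _ _ C0 fC))//.
  by rewrite -mulrA ler_wpM2l.
have cu f : lipf f -> cvgn (u f).
  move=> [C /lipschitz_cst_ge0 fC]; apply: cauchy_cvg; apply: cauchy_exP => e e0.
  have [k Hk] := expr_small (`|C| * D) c01 e0.
  exists (u f k); exists k => // n /= kn; rewrite /ball/=.
  apply: le_lt_trans Hk; rewrite -(subnKC kn); exact: uD.
pose L f := limn (u f).
have pL : positive_functional L.
  split.
  - move=> f g lf lg; rewrite /L.
    have -> : u (fun x => f x + g x) = u f + u g.
      by apply/funext => k; rewrite /u meanD//; exact: lipf_bounded_measurable.
    by apply: limD; exact: cu.
  - move=> a f lf; rewrite /L.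
    have -> : u (fun x => a * f x) = a *: u f.
      by apply/funext => k; rewrite /u meanZ//; exact: lipf_bounded_measurable.
    by apply: limZl_tmp; exact: cu.
  - move=> f g lf lg fg; apply: ler_lim; [exact: cu|exact: cu|].
    by near=> k; apply: mean_le => //; exact: lipf_bounded_measurable.
  - rewrite /L (_ : u _ = fun=> 1); first exact: lim_cst.
    by apply/funext => k; rewrite /u mean_cst.
pose mu : probability (borel X) R := riesz_measure pL cX.
have mmu k : dMK (m k) mu <= D * c ^+ k.
  apply: dMK_le => f f1; rewrite riesz_representation; last exact: lip1_lipf.
  have cuf := cu _ (lip1_lipf f1).
  have cv : `|u f k - u f n| @[n --> \oo] --> `|u f k - L f|.
    by apply: cvg_norm; apply: cvgB => //; exact: cvg_cst.
  rewrite -(cvg_lim _ cv)//; apply: limr_le; first by apply/cvg_ex; eexists; exact: cv.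
  near=> n; have kn : (k <= n)%N by near: n; exact: nbhs_infty_ge.
  by rewrite -(subnKC kn) -[D]mul1r; apply: uD => //; exact/lip1P.
exists mu; apply/eqP; rewrite eq_le dMK_ge0 andbT; apply/ler_addgt0Pr => e e0.
have [k Hk] := expr_small (D + D) c01 e0; rewrite add0r.
apply: le_trans (ltW Hk); rewrite (le_trans (dMK_triangle (m k.+1) _ _))//.
rewrite mulrDl lerD//.
  rewrite (le_trans (cPhi _ _))// -[leRHS]mul1r dMKC.
  by apply: ler_pM; rewrite ?dMK_ge0// ltW.
rewrite (le_trans (mmu _))// ler_wpM2l// exprS -[leRHS]mul1r.
by rewrite ler_wpM2r ?exprn_ge0// ltW.
Unshelve. all: by end_near. Qed.

End monge_kantorovich.

(** * Products of Borel probabilities *)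

Section products.
Context {R : realType} {X : pmetricType R} (cX : compact [set: X]).

Lemma compact_enumerable_base : exists e : nat -> set X,
  (forall n, open (e n)) /\
  forall x V, nbhs x V -> exists n, e n x /\ e n `<=` V.
Proof.
have [B cB [oB baseB]] := @compact_second_countable R X cX.
have : (B #<= [set: nat])%card by [].
move=> /pfcard_geP[B0|[e]].
  have [U [BU _] _] := baseB point setT filterT.
  by move: BU; rewrite B0.
exists e; split=> [n|x V /baseB[U [BU Ux] UV]]; first by apply: oB; exact: funS.
by have [n _ eU] := @surj _ _ _ _ e U BU; exists n; rewrite eU.
Qed.

(** The product sigma-algebra of [X ^ k] contains the open sets, since each is a
countable union of boxes. *)
Lemma tuple_continuous_measurable k (phi : k.-tuple X -> X) :
  (forall t e, 0 < e -> exists2 d, 0 < d & forall s,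
     (forall i, mdist (tnth t i) (tnth s i) < d) -> mdist (phi t) (phi s) < e) ->
  measurable_fun setT (phi : k.-tuple (borel X) -> borel X).
Proof.
move=> cphi; have [e [oe be]] := compact_enumerable_base.
refine (@measurability _ _ (k.-tuple (borel X)) (borel X) setT phi (@open X : set (set (borel X))) _ _) => // _ [U oU <-]; rewrite setTI.
pose box (u : k.-tuple nat) : set (k.-tuple (borel X)) :=
  \bigcap_i ((fun t => tnth t i) @^-1` e (tnth u i)).
have mbox u : measurable (box u).
  apply: fin_bigcap_measurable => [|i _]; first exact: finite_finset.
  rewrite -[X in measurable X]setTI; apply: measurable_tnth => //.
  by apply: sub_sigma_algebra; exact: oe.
have -> : phi @^-1` U = \bigcup_u (if pselect (box u `<=` phi @^-1` U) then box u else set0).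
  apply/seteqP; split=> [t Ut|t [u _]]; last by case: pselect => // h; exact: h.
  have /nbhs_ballP[r /= r0 rU] : nbhs (phi t) U by exact: open_nbhs_nbhs.
  have [d d0 dr] := cphi t r r0.
  have Hn i : exists n, e n (tnth t i) /\ e n `<=` ball (tnth t i) d.
    by apply: be; exact: nbhsx_ballx.
  have [n Hn'] := choice Hn.
  exists [tuple n i | i < k] => //; case: pselect => [_ i _|].
    by rewrite /= tnth_mktuple; have [] := Hn' i.
  case=> s bs; apply: rU; rewrite ballEmdist; apply: dr => i.
  have [_ /(_ (tnth s i))] := Hn' i; rewrite ballEmdist; apply.
  by have := bs i I; rewrite /= tnth_mktuple.
apply: countable_bigcupT_measurable => [|u]; first exact: countableP.
by case: pselect => h; [exact: mbox|exact: measurable0].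
Qed.

Section prod_probability.
Implicit Types (k : nat).

Lemma mean_prod_probabilityS k (mu : 'I_k.+1 -> probability (borel X) R)
    (F : k.+1.-tuple (borel X) -> R) : bounded_measurable F ->
  let G x := \int[prod_probability (fun i => mu (lift ord0 i))]_t F (tuple_cons (x, t)) in
  bounded_measurable G /\ \int[prod_probability mu]_t F t = \int[mu ord0]_x G x.
Proof.
move=> bF; have [mF [M FM]] := bF.
have bFc : bounded_measurable (F \o @tuple_cons _ (borel X) k).
  split; first by apply: measurableT_comp => //; exact: measurable_tuple_cons.
  by exists M => z; exact: FM.
have [bG EG] := mean_prod (mu ord0) (prod_probability (fun i => mu (lift ord0 i))) bFc.
by split=> //=; rewrite mean_distribution.
Qed.

Lemma bounded_measurable_tuple_cons k (F : k.+1.-tuple (borel X) -> R) x :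
  bounded_measurable F -> bounded_measurable (fun t => F (tuple_cons (x, t))).
Proof.
move=> [mF [M FM]]; split; last by exists M.
apply: measurableT_comp => //; apply: (measurableT_comp (@measurable_tuple_cons _ (borel X) k)).
exact: pair1_measurable.
Qed.

Lemma tnth_tuple_cons0 (T : Type) k (x : T) (t : k.-tuple T) :
  tnth [tuple of x :: t] ord0 = x.
Proof. by rewrite (tnth_nth x). Qed.

Lemma tnth_tuple_consS (T : Type) k (x : T) (t : k.-tuple T) i :
  tnth [tuple of x :: t] (lift ord0 i) = tnth t i.
Proof. by rewrite !(tnth_nth x) lift0. Qed.

Lemma mean_prod_probability_tnth k (mu : 'I_k -> probability (borel X) R) (f : borel X -> R) i :
  bounded_measurable f ->
  \int[prod_probability mu]_t f (tnth t i) = \int[mu i]_x f x.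
Proof.
move=> bf; have [mf [M fM]] := bf.
elim: k => [|k IH] in mu i *; first by case: i.
have [|_ ->] := @mean_prod_probabilityS k mu (fun t => f (tnth t i)).
  by split; [apply: measurableT_comp => //; exact: measurable_tnth|exists M].
case: (unliftP ord0 i) => [j ->|->].
  transitivity (\int[mu ord0]_x \int[mu (lift ord0 j)]_x f x); last exact: mean_cst.
  apply: eq_Rintegral => x _; rewrite -(IH (fun i => mu (lift ord0 i)) j).
  apply: eq_Rintegral => t _.
  by rewrite /tuple_cons tnth_tuple_consS.
apply: eq_Rintegral => x _; rewrite -[RHS](mean_cst (prod_probability (fun i => mu (lift ord0 i)))).
by apply: eq_Rintegral => t _; rewrite /tuple_cons tnth_tuple_cons0.
Qed.

Lemma prod_probability_box k (mu : 'I_k -> probability (borel X) R) (B : set (borel X)) :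
  measurable B -> (forall i, mu i B = 1%E) ->
  measurable [set t : k.-tuple (borel X) | forall i, B (tnth t i)] /\
  prod_probability mu [set t | forall i, B (tnth t i)] = 1%E.
Proof.
move=> mB; have mbox l : measurable [set t : l.-tuple (borel X) | forall i, B (tnth t i)].
  rewrite (_ : [set t | _] = \bigcap_i ((fun t => tnth t i) @^-1` B)); last first.
    by apply/seteqP; split => t /= H i => [_|]; exact: H.
  apply: fin_bigcap_measurable => [|i _]; first exact: finite_finset.
  by rewrite -[X in measurable X]setTI; exact: measurable_tnth.
split=> //; elim: k => [|k IH] in mu H *.
  by rewrite /= diracE mem_set// => -[].
rewrite /= /distribution /pushforward.
rewrite (_ : _ @^-1` _ = B `*` [set t : k.-tuple (borel X) | forall i, B (tnth t i)]).
  rewrite product_measure1E//; last exact: mbox.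
  rewrite -[RHS]mul1e; congr (_ * _)%E; first exact: H.
  by apply: IH => i; exact: H.
apply/seteqP; split=> -[x t]/=.
  move=> h; split=> [|i]; first by have := h ord0; rewrite tnth_tuple_cons0.
  by have := h (lift ord0 i); rewrite tnth_tuple_consS.
move=> [Bx Bt] i; case: (unliftP ord0 i) => [j ->|->].
  by rewrite tnth_tuple_consS.
by rewrite tnth_tuple_cons0.
Qed.

(** The factors are exchanged one at a time: integrating out the others leaves a
function of the [i]-th variable that is Lipschitz with constant [a i]. *)
Lemma prod_probability_dMK k (a : 'I_k -> R) (F : k.-tuple X -> R)
    (mu nu : 'I_k -> probability (borel X) R) :
  (forall i, 0 <= a i) -> bounded_measurable (F : k.-tuple (borel X) -> R) ->
  (forall s t, `|F s - F t| <= \sum_(i < k) a i * mdist (tnth s i) (tnth t i)) ->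
  `|\int[prod_probability mu]_t F t - \int[prod_probability nu]_t F t|
    <= \sum_(i < k) a i * dMK (mu i) (nu i).
Proof.
elim: k => [|k IH] in a F mu nu *.
  by move=> _ _ _; rewrite /= subrr normr0 big_ord0.
move=> a0 bF aF; have [bG ->] := mean_prod_probabilityS mu bF.
have [bH ->] := mean_prod_probabilityS nu bF.
move: bG bH; set G := fun x => \int[_]_t _; set H := fun x => \int[_]_t _ => bG bH.
rewrite big_ord_recl [leRHS]addrC (le_trans (ler_distD (\int[mu ord0]_x H x) _ _))//.
apply: lerD.
  apply: mean_dist_le => // x; apply: IH => // [|s t].
    exact: bounded_measurable_tuple_cons.
  apply: le_trans (aF _ _) _; rewrite big_ord_recl /tuple_cons !tnth_tuple_cons0 mdistxx.
  by rewrite mulr0 add0r; apply: ler_sum => i _; rewrite !tnth_tuple_consS.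
apply: le_dMK_lipschitz => // x y; apply: mean_dist_le.
- exact: bounded_measurable_tuple_cons.
- exact: bounded_measurable_tuple_cons.
- move=> t; apply: le_trans (aF _ _) _; rewrite big_ord_recl /tuple_cons !tnth_tuple_cons0.
  rewrite big1 ?addr0// => i _; by rewrite !tnth_tuple_consS mdistxx mulr0.
Qed.

End prod_probability.
End products.

(** * Supports and the generalized Markov operator *)

Section null_sets.
Context {R : realType} d (T : measurableType d).

Lemma mean_restrict (P : probability T R) (D : set T) (f : T -> R) :
  measurable D -> P D = 1%E -> bounded_measurable f ->
  \int[P]_(x in D) f x = \int[P]_x f x.
Proof.
move=> mD PD bf; rewrite /Rintegral; congr fine.
rewrite (@negligible_integral _ _ _ P setT (~` D))//.
- by rewrite setTD setCK.
- exact: measurableC.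
- exact: (bounded_measurable_integrable P bf).
- by rewrite [LHS]probability_setC// PD subee.
Qed.

End null_sets.

Section support.
Context {R : realType} {X : pmetricType R} (cX : compact [set: X]).
Implicit Types (B : set X) (nu : probability (borel X) R).

Lemma closed_measurable_borel B : closed B -> measurable (B : set (borel X)).
Proof.
move=> cB; rewrite -(setCK B); apply: measurableC; apply: sub_sigma_algebra.
exact: closed_openC.
Qed.

(** By second countability the complement of the support is a countable union of
null open sets. *)
Lemma supp_subset_measure1 B nu : closed B -> supp nu `<=` B -> nu B = 1%E.
Proof.
move=> cB sB; have mB := closed_measurable_borel cB.
have [e [oe be]] := compact_enumerable_base cX.
suff nuCB : nu (~` B) = 0%E.
  have := probability_setC nu mB; rewrite nuCB => /esym.
  have Bfin : nu B \is a fin_num by exact: fin_num_measure.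
  rewrite -(fineK Bfin) -EFinB => -[] /eqP; rewrite subr_eq0 => /eqP <-.
  by [].
pose N n : set (borel X) := if pselect (nu (e n) = 0%E) then e n else set0.
have mN n : measurable (N n).
  rewrite /N; case: pselect => h; last exact: measurable0.
  by apply: sub_sigma_algebra; exact: oe.
have NN n : nu.-negligible (N n).
  exists (N n); split => //; rewrite /N; case: pselect => h; [exact: h|exact: measure0].
have : nu.-negligible (~` B).
  apply: negligibleS (negligible_bigcup NN) => x nBx.
  have /existsNP[U /not_implyP[[oU Ux] nuU]] : ~ supp nu x by move/sB.
  have nuU0 : nu U = 0%E.
    by apply/eqP; rewrite eq_le measure_ge0 andbT leNgt; exact/negP.
  have [k [ekx ekU]] := be x U (open_nbhs_nbhs (conj oU Ux)).
  exists k => //; rewrite /N; case: pselect => // nk; exfalso; apply: nk.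
  apply/eqP; rewrite eq_le measure_ge0 andbT -nuU0; apply: le_measure => //;
    by rewrite inE; apply: sub_sigma_algebra => //; exact: oe.
by move=> /negligibleP; apply; exact: measurableC.
Qed.

Lemma mean_infdist_eq0 B nu : closed B -> B !=set0 -> supp nu `<=` B ->
  \int[nu]_x infdist B x = 0.
Proof.
move=> cB B0 sB; have mB := closed_measurable_borel cB.
have lB : lipf (infdist B) by exists 1; exact: infdist_lipschitz.
rewrite -(mean_restrict mB (supp_subset_measure1 cB sB)); last exact: lipf_bounded_measurable.
rewrite (@eq_Rintegral _ _ _ nu B (cst 0)); first by rewrite /cst Rintegral_cst// mul0r.
by move=> x; rewrite inE => Bx; rewrite infdist0.
Qed.

(** If [x] is off [B], the points whose distance to [B] exceeds half of that of [x]
form an open neighbourhood of [x], which is null when the integral vanishes. *)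
Lemma supp_subset B nu : closed B -> B !=set0 -> \int[nu]_x infdist B x = 0 ->
  supp nu `<=` B.
Proof.
move=> cB B0 I0 x sx; apply: contrapT => nBx.
have lB : lipf (infdist B) by exists 1; exact: infdist_lipschitz.
have d0 : 0 < infdist B x by exact: infdist_gt0.
have := @mean0_null _ _ _ nu (infdist B : borel X -> R)
  (lipf_bounded_measurable cX lB) _ I0 (infdist B x / 2).
rewrite divr_gt0// => /(_ (fun y => infdist_ge0 y B0) isT) null.
pose U := [set y | infdist B x / 2 < infdist B y].
have oU : open U.
  rewrite /U (_ : [set y | _] = infdist B @^-1` [set r | infdist B x / 2 < r])//.
  by apply: (open_comp _ (@open_gt _ (infdist B x / 2))) => y _; exact: lipf_continuous.
have /sx : open_nbhs x U by split => //; rewrite /U/= ltr_pdivrMr// mulr2n mulrDr mulr1 ltrDl.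
rewrite ltNge -null => /negP; apply; apply: le_measure; rewrite ?inE.
- exact: sub_sigma_algebra.
- apply: closed_measurable_borel.
  rewrite (_ : [set y | _] = infdist B @^-1` [set r | infdist B x / 2 <= r])//.
  by apply: (preimage_closed _ (@closed_ge _ (infdist B x / 2))) => y _; exact: lipf_continuous.
- by move=> y; exact: ltW.
Qed.

End support.

Section markov.
Context {R : realType} {X : pmetricType R} (cX : compact [set: X]).
Context {m n : nat} (S : gifsp X m n).
Implicit Types (mu : 'I_m -> probability (borel X) R) (nu : probability (borel X) R).

Lemma gmap_tuple_continuous j t e : 0 < e -> exists2 d, 0 < d & forall s,
  (forall i, mdist (tnth t i) (tnth s i) < d) ->
  mdist (gmap S j t) (gmap S j s) < e.
Proof.
move=> e0; have [c [c0 Hc]] := gmap_lipschitz S j.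
have c1 : 0 < c + 1 by rewrite ltr_wpDl.
exists (e / (c + 1)); first by rewrite divr_gt0.
move=> s ts; apply: le_lt_trans (Hc t s I I) _.
have : dmaxm mdist (tnth t) (tnth s) < e / (c + 1).
  by apply: bigmax_lt => [|i _]; [rewrite divr_gt0|exact: ts].
rewrite ltr_pdivlMr// mulrC; apply: le_lt_trans; rewrite ler_wpM2r//; last by rewrite lerDl.
exact: bigmax_ge_id.
Qed.

Lemma gmap_measurable j :
  measurable_fun setT (gmap S j : m.-tuple (borel X) -> borel X).
Proof. by apply: tuple_continuous_measurable => // t e; exact: gmap_tuple_continuous. Qed.

Lemma gmap_bounded_measurable j (f : borel X -> R) : bounded_measurable f ->
  bounded_measurable (fun t : m.-tuple (borel X) => f (gmap S j t)).
Proof.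
move=> [mf [M fM]]; split; last by exists M => t.
exact: measurableT_comp (gmap_measurable j).
Qed.

Lemma mean_weight_measure (F : 'I_n.+1 -> R) :
  \int[weight_measure S]_j F j = \sum_j weight S j * F j.
Proof.
have mI (A : set 'I_n.+1) : measurable A by [].
have FE : F = (fun j => \sum_i F i * \1_[set i] j).
  apply/funext => j; rewrite (bigD1 j)//= indicE mem_set// mulr1 big1 ?addr0// => i ij.
  by rewrite indicE memNset ?mulr0//= => ji; rewrite ji eqxx in ij.
rewrite {1}FE mean_sum; last first.
  by move=> i; apply: bounded_measurableZ; exact: bounded_measurable_indic.
apply: eq_bigr => j _; rewrite meanZ; last exact: bounded_measurable_indic.
rewrite mean_indic// mulrC; congr (_ * _).
rewrite /= /weight_measure (bigD1 j)//= diracE mem_set// mule1 big1 ?adde0// => i ij.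
by rewrite diracE memNset ?mule0//= => ji; rewrite ji eqxx in ij.
Qed.

Lemma mean_prod_weight d (T : measurableType d) (P : probability T R)
    (F : T * 'I_n.+1 -> R) : bounded_measurable F ->
  \int[(P \x weight_measure S)%E]_z F z = \sum_j weight S j * \int[P]_t F (t, j).
Proof.
move=> bF; have [mF [M FM]] := bF; have [_ ->] := mean_prod P (weight_measure S) bF.
have bFj j : bounded_measurable (fun t => F (t, j)).
  split; last by exists M => t.
  exact: (measurableT_comp mF (pair2_measurable j)).
under eq_Rintegral do rewrite mean_weight_measure.
rewrite mean_sum; last by move=> j; exact: bounded_measurableZ.
by apply: eq_bigr => j _; rewrite meanZ.
Qed.

Lemma measurable_uncurry_ord d d' (T : measurableType d) (T' : measurableType d')
    (F : T * 'I_n.+1 -> T') : (forall j, measurable_fun setT (fun t => F (t, j))) ->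
  measurable_fun setT F.
Proof.
move=> mF _ A mA; rewrite setTI.
rewrite (_ : F @^-1` A = \bigcup_j (((fun t => F (t, j)) @^-1` A) `*` [set j])).
  apply: fin_bigcup_measurable => [|j _]; first exact: finite_finset.
  by apply: measurableX => //; rewrite -[X in measurable X]setTI; exact: mF.
apply/seteqP; split=> -[t j]/=; first by exists j.
by move=> [i _ [/= Fti ->]].
Qed.

Lemma bounded_measurable_uncurry_ord d (T : measurableType d) (F : T * 'I_n.+1 -> R) :
  (forall j, bounded_measurable (fun t => F (t, j))) -> bounded_measurable F.
Proof.
move=> bF; split; first by apply: measurable_uncurry_ord => j; case: (bF j).
have [M HM] := choice (fun j => (bF j).2).
exists (\sum_j `|M j|) => -[t j]; rewrite (bigD1 j)//= ler_wpDr ?sumr_ge0//.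
by rewrite (le_trans (HM j t))// ler_norm.
Qed.

(** The law of the image of a random tuple under a map drawn with the weights. *)
Lemma markov_image_exists mu : exists nu, forall f : borel X -> R,
  bounded_measurable f ->
  \int[nu]_x f x = \sum_j weight S j * \int[prod_probability mu]_t f (gmap S j t).
Proof.
pose h (z : m.-tuple (borel X) * 'I_n.+1) : borel X := gmap S z.2 z.1.
have mh : measurable_fun setT h.
  by apply: measurable_uncurry_ord => j; exact: gmap_measurable.
pose h' : {mfun _ >-> _} := HB.pack_for {mfun _ >-> _} h (isMeasurableFun.Build _ _ _ _ h mh).
exists (distribution (prod_probability mu \x weight_measure S)%E h') => f bf.
rewrite mean_distribution// mean_prod_weight//.
by apply: bounded_measurable_uncurry_ord => j; exact: gmap_bounded_measurable.
Qed.

Lemma sum_weight_le (F : 'I_n.+1 -> R) c : (forall j, F j <= c) ->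
  \sum_j weight S j * F j <= c.
Proof.
move=> Fc; rewrite -[leRHS]mul1r -(weight_sum1 S) mulr_suml; apply: ler_sum => j _.
by rewrite ler_wpM2l// ltW// weight_gt0.
Qed.

Context (a : 'I_m -> R) (a0 : forall i, 0 <= a i)
  (aS : forall j, tuple_contraction a (gmap S j)).

Lemma markov_image_contraction mu mu' nu nu' :
  is_markov_image S mu nu -> is_markov_image S mu' nu' ->
  dMK nu nu' <= \sum_(i < m) a i * dMK (mu i) (mu' i).
Proof.
move=> Mnu Mnu'; apply: dMK_le => f f1.
have cf := lipf_continuous (lip1_lipf f1).
rewrite Mnu// Mnu'// -sumrB (le_trans (ler_norm_sum _ _ _))//.
under eq_bigr do rewrite -mulrBr normrM (gtr0_norm (weight_gt0 S _)).
apply: sum_weight_le => j; apply: prod_probability_dMK => //.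
  exact/gmap_bounded_measurable/continuous_bounded_measurable.
by move=> s t; apply: le_trans (f1 _ _) _; exact: aS.
Qed.

Lemma markov_fixpoint_exists (T : probability (borel X) R -> 'I_m -> probability (borel X) R) c :
  0 <= c < 1 ->
  (forall nu nu', \sum_(i < m) a i * dMK (T nu i) (T nu' i) <= c * dMK nu nu') ->
  exists nu, is_markov_image S (T nu) nu.
Proof.
move=> c01 Tc; have [Phi HPhi] := choice (fun nu => markov_image_exists (T nu)).
have MPhi nu : is_markov_image S (T nu) (Phi nu).
  by move=> f cf; apply: HPhi; exact: continuous_bounded_measurable.
have [|nu nu0] := @dMK_contraction_fixpoint _ _ cX Phi c c01.
  by move=> nu nu'; apply: le_trans (Tc nu nu'); exact: markov_image_contraction.
exists nu => f cf; rewrite -MPhi//; apply: mean_eq => A mA.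
by apply/esym; exact: (dMK_eq0_borel cX nu0 mA).
Qed.

(** Replacing each [tnth t i] by a nearest point of [A i] gives a tuple sent into [B],
so the distance to [B] after a map is at most the weighted sum of the distances to
the [A i] before it. Fixed measures then have a null integral. *)
Lemma markov_image_infdist (A : 'I_m -> set X) (B : set X) mu nu :
  (forall i, Kstar X (A i)) -> B !=set0 -> hutchinson_op S A `<=` B ->
  is_markov_image S mu nu ->
  \int[nu]_x infdist B x <= \sum_(i < m) a i * \int[mu i]_x infdist (A i) x.
Proof.
move=> KA B0 AB Mnu.
have lip (C : set X) : C !=set0 -> lipf (infdist C) by exists 1; exact: infdist_lipschitz.
have bA i : bounded_measurable (infdist (A i) : borel X -> R).
  by apply: lipf_bounded_measurable => //; apply: lip; have [] := KA i.
rewrite Mnu; last exact/lipf_continuous/lip.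
have bAt i : bounded_measurable (fun t : m.-tuple (borel X) => infdist (A i) (tnth t i)).
  have [mA [M AM]] := bA i; split; last by exists M.
  by apply: measurableT_comp => //; exact: measurable_tnth.
apply: sum_weight_le => j.
apply: (@le_trans _ _ (\int[prod_probability mu]_t \sum_(i < m) a i * infdist (A i) (tnth t i))).
  apply: mean_le.
  - by apply: gmap_bounded_measurable; exact/lipf_bounded_measurable/lip.
  - by apply: bounded_measurable_sum => i; exact: bounded_measurableZ.
  move=> t.
  have Hs i : exists y, A i y /\ mdist (tnth t i) y = infdist (A i) (tnth t i).
    by have [cA A0] := KA i; have [y Ay yt] := infdist_attained (tnth t i) cA A0; exists y.
  have [s Hs'] := choice Hs.
  have Bs : B (gmap S j [tuple s i | i < m]).
    apply: AB; exists j => //; exists [tuple s i | i < m] => //= i.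
    by rewrite tnth_mktuple; have [] := Hs' i.
  rewrite (le_trans (infdist_le _ Bs))// (le_trans (aS _ _ _))//.
  by apply: ler_sum => i _; rewrite tnth_mktuple; have [_ ->] := Hs' i.
rewrite mean_sum; last by move=> i; exact: bounded_measurableZ.
by apply: ler_sum => i _; rewrite meanZ// mean_prod_probability_tnth.
Qed.

End markov.

(** * The Hutchinson operator and Lipschitz constants *)

Section hutchinson_operator.
Context {R : realType} {X : pmetricType R} (cX : compact [set: X]).

Lemma Kstar_closed (A : set X) : Kstar X A -> closed A.
Proof. by move=> [cA _]; apply: compact_closed cA; exact: metric_hausdorff. Qed.

(** A point minimising [mdist x (f x)] is fixed: its image would otherwise do better. *)
Lemma compact_contraction_fixpoint (f : X -> X) c : c < 1 ->
  (forall x y, mdist (f x) (f y) <= c * mdist x y) -> exists x, f x = x.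
Proof.
move=> c1 fc.
have lf : lipschitz_cst (1 + c) (fun x => mdist x (f x)).
  move=> x y; have := metric_triangle x y (f x); have := metric_triangle y (f y) (f x).
  have := metric_triangle y x (f y); have := metric_triangle x (f x) (f y).
  have := fc x y; rewrite (metric_sym y x) (metric_sym (f y) (f x)) ler_norml.
  by move=> *; apply/andP; split; lra.
have [||y _ ymin] := @compact_EVT_min X R (fun x => mdist x (f x)) setT _ cX.
- by exists point.
- exact/continuous_subspaceT/lipschitz_cst_continuous/lf.
exists y; apply/esym/mdist_positivity/eqP; rewrite eq_le mdist_ge0 andbT.
have := ymin (f y); rewrite inE => /(_ I) yfy.
have := le_trans yfy (fc _ _); have := mdist_ge0 y (f y); nra.
Qed.

(** The greatest postfixed set of a monotone operator is a fixed point; it is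
closed because the closure of a postfixed set is postfixed. *)
Lemma monotone_Kstar_fixpoint (G : set X -> set X) :
  (forall A A', A `<=` A' -> G A `<=` G A') ->
  (forall A, Kstar X A -> Kstar X (G A)) ->
  (exists A, A !=set0 /\ A `<=` G A) -> exists A, Kstar X A /\ G A = A.
Proof.
move=> mG KG [A0 [[x A0x] A0G]].
pose P := \bigcup_(A in [set A | A `<=` G A]) A.
have PG : P `<=` G P.
  move=> y [A AG Ay]; apply: (mG A) => [z Az|]; first by exists A.
  exact: AG.
have GP : G P `<=` P.
  by move=> y GPy; exists (G P) => //; exact: mG.
have KP : Kstar X (closure P).
  split; last by exists x; apply: subset_closure; exists A0.
  by apply: subclosed_compact cX _ => //; exact: closed_closure.
have cPG : closure P `<=` G (closure P).
  have -> : G (closure P) = closure (G (closure P)).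
    by apply: (closure_id _).1; apply: Kstar_closed; exact: KG.
  by apply: closure_subset => y /PG; apply: mG; exact: subset_closure.
have PE : P = closure P.
  apply/seteqP; split; first exact: subset_closure.
  by move=> y cPy; exists (closure P).
by exists P; rewrite {1}PE; split=> //; apply/seteqP.
Qed.

Context {m n : nat} (S : gifsp X m n).
Implicit Types (A : 'I_m -> set X).

Lemma hutchinson_opS A A' : (forall i, A i `<=` A' i) ->
  hutchinson_op S A `<=` hutchinson_op S A'.
Proof.
move=> AA' _ [j _ [t At <-]]; exists j => //; exists t => // i.
exact/AA'/At.
Qed.

Lemma hutchinson_op_Kstar A : (forall i, Kstar X (A i)) -> Kstar X (hutchinson_op S A).
Proof.
move=> KA; split; last first.
  have [s As] := choice (fun i => (KA i).2).
  exists (gmap S ord0 [tuple s i | i < m]), ord0 => //; exists [tuple s i | i < m] => // i.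
  by rewrite tnth_mktuple.
(* Tuples are read as row vectors, whose topology makes products of compact sets
   compact. *)
pose psi j (v : 'rV[X]_m) := gmap S j [tuple v ord0 i | i < m].
have -> : hutchinson_op S A = \bigcup_(j in [set` [pred j : 'I_n.+1 | true]])
    (psi j @` [set v : 'rV[X]_m | forall i, A i (v ord0 i)]).
  apply/seteqP; split=> [_ [j _ [t At <-]]|_ [j _ [v Av <-]]]; exists j => //.
    exists (\row_i tnth t i) => [i|]; first by rewrite mxE; exact: At.
    by congr (gmap S j _); apply: eq_from_tnth => i; rewrite tnth_mktuple mxE.
  by exists [tuple v ord0 i | i < m] => // i; rewrite tnth_mktuple; exact: Av.
rewrite bigcup_pred; apply: bigsetU_compact => j _.
apply: continuous_compact; last by apply: rV_compact => i; have [] := KA i.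
apply: continuous_subspaceT => v.
apply: (@cvg_ballP R X _ (nbhs (v : 'rV[X]_m)) (nbhs_filter _) (psi j) _).2 => e e0.
have [d d0 Hd] := gmap_tuple_continuous S j [tuple v ord0 i | i < m] e0.
apply/nbhs_ballP; exists d => //= w [_ vw]; rewrite ballEmdist; apply: Hd => i.
by have := vw ord0 i; rewrite !tnth_mktuple ballEmdist.
Qed.

Context (a : 'I_m -> R) (a0 : forall i, 0 <= a i)
  (aS : forall j, tuple_contraction a (gmap S j)).

Lemma hutchinson_op_contraction A A' :
  (forall i, Kstar X (A i)) -> (forall i, Kstar X (A' i)) ->
  hausdorff_dist (hutchinson_op S A) (hutchinson_op S A') <=
  \sum_(i < m) a i * hausdorff_dist (A i) (A' i).
Proof.
move=> KA KA'; apply/hausdorff_dist_le; [exact: hutchinson_op_Kstar|exact: hutchinson_op_Kstar|].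
have H (C C' : 'I_m -> set X) : (forall i, Kstar X (C i)) -> (forall i, Kstar X (C' i)) ->
    within_dist (\sum_(i < m) a i * hausdorff_dist (C i) (C' i))
      (hutchinson_op S C) (hutchinson_op S C').
  move=> KC KC' _ [j _ [t Ct <-]].
  have Hs i : exists y, C' i y /\ mdist (tnth t i) y <= hausdorff_dist (C i) (C' i).
    have [CC' _] := (hausdorff_dist_le _ (KC i) (KC' i)).1 (lexx _).
    by have [y C'y ty] := CC' _ (Ct i); exists y.
  have [s Hs'] := choice Hs; exists (gmap S j [tuple s i | i < m]).
    exists j => //; exists [tuple s i | i < m] => // i.
    by rewrite tnth_mktuple; have [] := Hs' i.
  apply: le_trans (aS _ _ _) _; apply: ler_sum => i _; rewrite tnth_mktuple ler_wpM2l//.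
  by have [] := Hs' i.
split; first exact: H.
by under eq_bigr do rewrite hausdorff_dist_sym; exact: H.
Qed.

End hutchinson_operator.

Section Lip_attained.
Context {R : realType} {T U : Type} (D : set T) (dT : T -> T -> R) (dU : U -> U -> R).

(** The infimum defining [Lip] is attained: where [dT x y] is positive every
admissible constant is at least [dU (f x) (f y) / dT x y], and where it vanishes all
constants say the same. *)
Lemma Lip_lipschitz_with (f : T -> U) c :
  (forall x y, D x -> D y -> 0 <= dT x y) -> lipschitz_with D dT dU c f ->
  exists l, [/\ Lip D dT dU f = l%:E, lipschitz_with D dT dU l f & l <= c].
Proof.
move=> d0 fc; set C := [set c | lipschitz_with D dT dU c f].
have C0 : C !=set0 by exists c.
have lbC : has_lbound C by exists 0 => b [].
exists (inf C); split; first exact: ereal_inf_EFin.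
  split=> [|x y Dx Dy]; first by apply: lb_le_inf => // b [].
  have := d0 x y Dx Dy; rewrite le_eqVlt => /predU1P[dxy|dxy].
    by have [_ /(_ x y Dx Dy)] := fc; rewrite -dxy !mulr0.
  rewrite -ler_pdivrMr//; apply: lb_le_inf => // b [_ /(_ x y Dx Dy)].
  by rewrite -ler_pdivrMr.
exact: ge_inf.
Qed.

Lemma Lip_le (f : T -> U) c : lipschitz_with D dT dU c f -> (Lip D dT dU f <= c%:E)%E.
Proof. by move=> fc; apply: ereal_inf_lbound; exists c. Qed.

End Lip_attained.

(** * The induced infinite iterated function system *)

(** The arguments of an operator that the induced system sees: a variable, followed
by copies of a parameter. *)
Definition fam_cons (T : Type) (p : nat) (x y : T) (i : 'I_p.+1) : T :=
  if i == ord0 then x else y.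

Lemma fam_consS T p (x y : T) (i : 'I_p) : fam_cons x y (lift ord0 i) = y.
Proof. by []. Qed.

Lemma fam_cons_same T p (x : T) : @fam_cons T p x x = fun=> x.
Proof. by apply/funext => i; rewrite /fam_cons; case: ifP. Qed.

Section induced_system.
Context {R : realType} {X : pmetricType R} (cX : compact [set: X]).
Context {p n : nat} (S : gifsp X p.+1 n).
Implicit Types (g : set X * probability (borel X) R) (mu nu : probability (borel X) R).

(** Fubini's theorem; the restriction of the parameters to [g.1] does not change the
integral because [g.1] contains the support of [g.2] and so has full measure. *)
Lemma is_imarkov_imageE g mu nu : Gamma X g ->
  is_imarkov_image (induced_iifsp S g) mu nu <-> is_markov_image S (fam_cons mu g.2) nu.
Proof.
move=> [KB sB]; have cB := Kstar_closed KB.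
suff H f : continuous f ->
    \int[mu]_x \int[index_probability (induced_iifsp S g)]_(theta in index_set (induced_iifsp S g))
      f (imap (induced_iifsp S g) theta x) =
    \sum_j weight S j * \int[prod_probability (fam_cons mu g.2)]_t f (gmap S j t).
  by split=> h f cf; rewrite h// H.
move=> cf; have bf := continuous_bounded_measurable cX cf.
have bfj j := gmap_bounded_measurable cX S j bf.
have mB := closed_measurable_borel cB.
have [mbox Pbox] := @prod_probability_box _ X p (fun=> g.2) g.1 mB
  (fun=> supp_subset_measure1 cX cB sB).
have EB : index_set (induced_iifsp S g) =
    [set t : p.-tuple (borel X) | forall i, g.1 (tnth t i)] `*` [set: 'I_n.+1].
  by apply/seteqP; split=> -[t j] //= [].
have bH x : bounded_measurable (fun theta : p.-tuple (borel X) * 'I_n.+1 =>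
    f (gmap S theta.2 (tuple_cons (x, theta.1)))).
  apply: bounded_measurable_uncurry_ord => j /=.
  exact: (bounded_measurable_tuple_cons x (bfj j)).
pose G j x := \int[prod_probability (fun=> g.2)]_t f (gmap S j (tuple_cons (x, t))).
have tailE : (fun i : 'I_p => fam_cons mu g.2 (lift ord0 i)) = (fun=> g.2) by [].
have bG j : bounded_measurable (G j : borel X -> R).
  by have [bG _] := mean_prod_probabilityS (fam_cons mu g.2) (bfj j).
transitivity (\int[mu]_x \sum_j weight S j * G j x).
  apply: eq_Rintegral => x _; rewrite mean_restrict.
  - by rewrite (mean_prod_weight S _ (bH x)).
  - by rewrite EB; apply: measurableX.
  - rewrite EB; apply: etrans (product_measure1E _ _ mbox measurableT) _.
    by rewrite -[RHS]mule1; congr (_ * _)%E; [exact: Pbox|exact: probability_setT].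
  - exact: bH.
rewrite mean_sum; last by move=> j; exact: bounded_measurableZ.
apply: eq_bigr => j _; rewrite meanZ//; congr (_ * _).
by have [_ ->] := mean_prod_probabilityS (fam_cons mu g.2) (bfj j).
Qed.

Lemma induced_hutchinsonE g A :
  \bigcup_(theta in index_set (induced_iifsp S g)) (imap (induced_iifsp S g) theta @` A) =
  hutchinson_op S (fam_cons A g.1).
Proof.
apply/seteqP; split=> [_ [[t j] /= Bt [x Ax <-]]|_ [j _ [t At <-]]].
  exists j => //; exists [tuple of x :: t] => // i.
  case: (unliftP ord0 i) => [k ->|->]; first by rewrite tnth_tuple_consS; exact: Bt.
  by rewrite tnth_tuple_cons0.
exists ([tuple of behead t], j) => /=.
  by move=> i; rewrite tnth_behead; have := At (inord i.+1); rewrite /fam_cons -val_eqE/= inordK ?ltnS.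
exists (tnth t ord0); first exact: (At ord0).
by congr (gmap S j _); rewrite [RHS]tuple_eta.
Qed.

End induced_system.

(** * Attractors and invariant measures *)

Section fixed_points.
Context {R : realType} {X : pmetricType R} (cX : compact [set: X]).
Context {p n : nat} (S : gifsp X p.+1 n).
Context (a : 'I_p.+1 -> R) (a_ge0 : forall i, 0 <= a i) (a_lt1 : \sum_i a i < 1)
  (aS : forall j, tuple_contraction a (gmap S j)).
Implicit Types (g : set X * probability (borel X) R) (A B : set X)
  (mu nu : probability (borel X) R).

Let ratio : R := (\sum_(i < p) a (lift ord0 i)) / (1 - a ord0).

Lemma first_ratio_lt1 : a ord0 < 1.
Proof.
apply: le_lt_trans a_lt1; rewrite big_ord_recl lerDl.
by apply: sumr_ge0 => i _; exact: a_ge0.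
Qed.

Lemma ratio_bounds : 0 <= ratio < 1.
Proof.
have a1 : 0 < 1 - a ord0 by rewrite subr_gt0 first_ratio_lt1.
rewrite /ratio divr_ge0 ?(ltW a1)//=; last by apply: sumr_ge0 => i _; exact: a_ge0.
rewrite ltr_pdivrMr// mul1r ltrBrDl.
by apply: le_lt_trans a_lt1; rewrite big_ord_recl.
Qed.

Lemma fam_cons_Kstar A B : Kstar X A -> Kstar X B ->
  forall i, Kstar X (@fam_cons _ p A B i).
Proof. by move=> KA KB i; rewrite /fam_cons; case: ifP. Qed.

(** [T] says which arguments move with the unknown set. The singleton of a fixed point
of one of the maps is a nonempty postfixed set. *)
Lemma hutchinson_fixpoint_exists (T : set X -> 'I_p.+1 -> set X) :
  (forall A A', A `<=` A' -> forall i, T A i `<=` T A' i) ->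
  (forall A, Kstar X A -> forall i, Kstar X (T A i)) ->
  (exists x t, (forall i, T [set x] i (t i)) /\
     gmap S ord0 [tuple t i | i < p.+1] = x) ->
  exists A, Kstar X A /\ hutchinson_op S (T A) = A.
Proof.
move=> mT KT [x [t [Tt tx]]].
apply: (monotone_Kstar_fixpoint cX) => [A A' AA'|A KA|].
- by apply: hutchinson_opS; exact: mT.
- exact/hutchinson_op_Kstar/KT.
- exists [set x]; split; first by exists x.
  move=> _ ->; exists ord0 => //; exists [tuple t i | i < p.+1] => // i.
  by rewrite tnth_mktuple.
Qed.

Lemma attractor_spec : Kstar X (attractor S) /\
  hutchinson_op S (fun=> attractor S) = attractor S.
Proof.
apply: (@xgetPex _ set0 [set A | Kstar X A /\ hutchinson_op S (fun=> A) = A]).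
apply: hutchinson_fixpoint_exists => //.
have [|x xE] := compact_contraction_fixpoint cX
  (f := fun x => gmap S ord0 [tuple x | i < p.+1]) a_lt1.
  move=> x y; apply: le_trans (aS _ _ _) _; rewrite mulr_suml.
  by apply: ler_sum => i _; rewrite !tnth_mktuple.
by exists x, (fun=> x).
Qed.

Lemma iattractor_spec g : Gamma X g -> Kstar X (EV S g).1 /\
  hutchinson_op S (fam_cons (EV S g).1 g.1) = (EV S g).1.
Proof.
move=> [KB _].
have KF A : Kstar X A -> Kstar X (hutchinson_op S (fam_cons A g.1)).
  by move=> KA; apply: hutchinson_op_Kstar; exact: fam_cons_Kstar.
suff [A [KA AE]] : exists A, Kstar X A /\ hutchinson_op S (fam_cons A g.1) = A.
  have ex : exists A, Kstar X A /\ A = closure (\bigcup_(theta in index_set (induced_iifsp S g))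
      (imap (induced_iifsp S g) theta @` A)).
    exists A; split=> //; rewrite induced_hutchinsonE AE.
    by apply: (closure_id _).1; exact: Kstar_closed.
  have [KEV] := xgetPex set0 ex; rewrite induced_hutchinsonE => E.
  split=> //; rewrite [RHS]E; apply: (closure_id _).1; apply: Kstar_closed; exact: KF.
apply: hutchinson_fixpoint_exists => [A A' AA' i|A KA|].
- by rewrite /fam_cons; case: ifP => _ x //; exact: AA'.
- exact: fam_cons_Kstar.
have [_ [b Bb]] := KB.
have [|x xE] := compact_contraction_fixpoint cX
  (f := fun x => gmap S ord0 [tuple fam_cons x b i | i < p.+1]) first_ratio_lt1.
  move=> x y; apply: le_trans (aS _ _ _) _; rewrite big_ord_recl big1 ?addr0 => [|i _].
    by rewrite !tnth_mktuple.
  by rewrite !tnth_mktuple !fam_consS mdistxx mulr0.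
exists x, (fam_cons x b); split=> // i.
by rewrite /fam_cons; case: ifP.
Qed.

Lemma hutchinson_measure_spec :
  is_markov_image S (fun=> hutchinson_measure S) (hutchinson_measure S).
Proof.
apply: (@xgetPex _ _ [set mu | is_markov_image S (fun=> mu) mu]).
apply: (@markov_fixpoint_exists _ _ cX _ _ S a a_ge0 aS (fun mu _ => mu) (\sum_i a i)).
  by rewrite a_lt1 sumr_ge0.
by move=> mu nu; rewrite mulr_suml.
Qed.

Lemma ihutchinson_measure_spec g : Gamma X g ->
  is_markov_image S (fam_cons (EV S g).2 g.2) (EV S g).2.
Proof.
move=> Gg; apply/(is_imarkov_imageE cX S _ _ Gg).
apply: (@xgetPex _ _ [set mu | is_imarkov_image (induced_iifsp S g) mu mu]).
have [||mu Mmu] := @markov_fixpoint_exists _ _ cX _ _ S a a_ge0 aS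
   (fun mu => fam_cons mu g.2) (a ord0).
- by rewrite a_ge0 first_ratio_lt1.
- move=> mu nu; rewrite big_ord_recl big1 ?addr0// => i _.
  rewrite !fam_consS; apply/eqP; rewrite mulf_eq0; apply/orP; right.
  rewrite eq_le dMK_ge0// andbT; apply: dMK_le => // f _.
  by rewrite subrr normr0.
- by exists mu; apply/(is_imarkov_imageE cX S _ _ Gg).
Qed.

(** The integral [I] of the distance to the attractor satisfies [I <= a ord0 * I],
because the parameters are almost surely in [g.1], so it vanishes. *)
Lemma EV_Gamma g : Gamma X g -> Gamma X (EV S g).
Proof.
move=> Gg; have [KB sB] := Gg; have [KA AE] := iattractor_spec Gg.
split=> //; have [_ A0] := KA; have [_ B0] := KB.
have cA := Kstar_closed KA; have cB := Kstar_closed KB.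
apply: (supp_subset cX cA A0); apply/eqP; rewrite eq_le andbC.
rewrite Rintegral_ge0/=; last by move=> x _; exact: infdist_ge0.
have AEsub : hutchinson_op S (fam_cons (EV S g).1 g.1) `<=` (EV S g).1 by rewrite AE.
have := markov_image_infdist cX aS (fam_cons_Kstar KA KB) A0 AEsub
  (ihutchinson_measure_spec Gg).
rewrite big_ord_recl big1 ?addr0 => [|i _]; last first.
  by rewrite !fam_consS (mean_infdist_eq0 cX cB B0 sB) mulr0.
by have := first_ratio_lt1; rewrite /fam_cons eqxx; nra.
Qed.

(** Here all the arguments move and the same integral is at most [\sum_i a i] times
itself. *)
Lemma attractor_Gamma : Gamma X (attractor S, hutchinson_measure S).
Proof.
have [KA AE] := attractor_spec; split=> //=; have [_ A0] := KA.
have cA := Kstar_closed KA.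
apply: (supp_subset cX cA A0); apply/eqP; rewrite eq_le andbC.
rewrite Rintegral_ge0/=; last by move=> x _; exact: infdist_ge0.
have AEsub : hutchinson_op S (fun=> attractor S) `<=` attractor S by rewrite AE.
have := markov_image_infdist cX aS (fun=> KA) A0 AEsub hutchinson_measure_spec.
by rewrite -mulr_suml; move: a_lt1; set s := \sum_(i < _) _; nra.
Qed.

(** The distance [u] of the solutions satisfies [u <= l * max u v], where [v] is that
of the parameters. As [l < 1], the maximum can be taken to be [v]. *)
Lemma fixed_set_dist l A A' B B' : 0 <= l < 1 ->
  lipschitz_with [set C : 'I_p.+1 -> set X | forall i, Kstar X (C i)]
    (dmaxm hausdorff_dist) hausdorff_dist l (hutchinson_op S) ->
  Kstar X A -> Kstar X A' -> Kstar X B -> Kstar X B' ->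
  hutchinson_op S (fam_cons A B) = A -> hutchinson_op S (fam_cons A' B') = A' ->
  hausdorff_dist A A' <= l * hausdorff_dist B B'.
Proof.
move=> /andP[l0 l1] [_ Fl] KA KA' KB KB' AE AE'.
have := Fl _ _ (fam_cons_Kstar KA KB) (fam_cons_Kstar KA' KB'); rewrite AE AE'.
have h0 := hausdorff_dist_ge0 KA KA'; have h0' := hausdorff_dist_ge0 KB KB'.
have : dmaxm hausdorff_dist (@fam_cons _ p A B) (@fam_cons _ p A' B') <=
    Num.max (hausdorff_dist A A') (hausdorff_dist B B').
  apply: bigmax_le => [|i _]; first by rewrite le_max h0.
  by rewrite /fam_cons le_max; case: ifP => _; rewrite lexx ?orbT.
have [uv|uv] := leP (hausdorff_dist A A') (hausdorff_dist B B'); nra.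
Qed.

(** The distance [u] of the solutions satisfies [u <= a ord0 * u + s * v], where [v] is
that of the parameters and [s] the sum of the other ratios; solve for [u]. *)
Lemma fixed_measure_dist mu mu' nu nu' :
  is_markov_image S (fam_cons mu nu) mu -> is_markov_image S (fam_cons mu' nu') mu' ->
  dMK mu mu' <= ratio * dMK nu nu'.
Proof.
move=> M M'; have := markov_image_contraction cX a_ge0 aS M M'.
rewrite big_ord_recl; under eq_bigr do rewrite !fam_consS.
rewrite -mulr_suml /fam_cons eqxx /ratio => H.
have a1 : 0 < 1 - a ord0 by rewrite subr_gt0 first_ratio_lt1.
rewrite mulrAC ler_pdivlMr//; move: H.
by rewrite mulrBr mulr1 lerBlDl mulrC.
Qed.

End fixed_points.

(** * The evaluation map *)

Section dmax.
Context {R : realType} {X : pmetricType R} (cX : compact [set: X]).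
Implicit Types g : set X * probability (borel X) R.

Lemma dmax_ge0 g g' : Gamma X g -> Gamma X g' -> 0 <= dmax g g'.
Proof. by move=> [K _] [K' _]; rewrite le_max hausdorff_dist_ge0. Qed.

Lemma dmax_triangle g' g g'' : Gamma X g -> Gamma X g' -> Gamma X g'' ->
  dmax g g'' <= dmax g g' + dmax g' g''.
Proof.
move=> [K _] [K' _] [K'' _]; rewrite /dmax ge_max; apply/andP; split.
  by apply: le_trans (hausdorff_dist_triangle K K' K'') _; rewrite lerD// le_max lexx.
by apply: le_trans (dMK_triangle cX g'.2 _ _) _; rewrite lerD// le_max lexx orbT.
Qed.

End dmax.

(** The point [x] is only assumed fixed up to distance zero, since probabilities that
agree on Borel sets need not be equal. *)
Lemma contraction_iter_cvg {R : realType} (T : Type) (D : set T) (d : T -> T -> R)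
    (f : T -> T) c x0 x :
  (forall u v, D u -> D v -> 0 <= d u v) ->
  (forall u v w, D u -> D v -> D w -> d u w <= d u v + d v w) ->
  (forall u, D u -> D (f u)) -> c < 1 -> lipschitz_with D d d c f ->
  D x0 -> D x -> d (f x) x <= 0 ->
  d (iter k f x0) x @[k --> \oo] --> (0 : R).
Proof.
move=> d0 dtri Df c1 [c0 fc] Dx0 Dx fx.
have Dk k : D (iter k f x0) by elim: k => // k IH; exact: Df.
have bnd k : d (iter k f x0) x <= d x0 x * c ^+ k.
  elim: k => [|k IH]; first by rewrite expr0 mulr1.
  rewrite iterS (le_trans (dtri _ (f x) _ _ _ _))//; [exact: Df|exact: Df|].
  rewrite exprS mulrCA -[leRHS]addr0 lerD// (le_trans (fc _ _ _ _))//.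
  by rewrite ler_wpM2l.
have cc : `|c| < 1 by rewrite ger0_norm.
have cv := cvg_geometric (d x0 x) cc.
apply: (squeeze_cvgr _ (cvg_cst 0) cv).
by near=> k; rewrite d0//= bnd.
Unshelve. all: by end_near. Qed.

Theorem theorem3p23 (R : realType) (X : pmetricType R) (p n : nat)
    (S : gifsp X p.+1 n) (a : 'I_p.+1 -> R) :
  compact [set: X] ->
  (2 <= p.+1)%N ->
  (forall i, 0 <= a i) ->
  \sum_(i < p.+1) a i < 1 ->
  (forall j, tuple_contraction a (gmap S j)) ->
  let bound := maxe
    (Lip [set A : 'I_p.+1 -> set X | forall i, Kstar X (A i)]
       (dmaxm hausdorff_dist) hausdorff_dist (hutchinson_op S))
    ((\sum_(i < p) a (lift ord0 i)) / (1 - a ord0))%:E in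
  [/\ (forall g, Gamma X g -> Gamma X (EV S g)),
      lipschitz_contraction (Gamma X) dmax dmax (EV S),
      (Lip (Gamma X) dmax dmax (EV S) <= bound)%E /\
        (bound < 1)%E,
      Gamma X (attractor S, hutchinson_measure S)
    & forall g0, Gamma X g0 ->
        dmax (iter k (EV S) g0) (attractor S, hutchinson_measure S)
          @[k --> \oo] --> (0 : R)].
Proof.
move=> cX _ a0 a1 aS bound.
set D := [set A : 'I_p.+1 -> set X | _] in bound *.
have dD A A' : D A -> D A' -> 0 <= dmaxm hausdorff_dist A A'.
  by move=> _ _; exact: bigmax_ge_id.
have Fsum : lipschitz_with D (dmaxm hausdorff_dist) hausdorff_dist
    (\sum_i a i) (hutchinson_op S).
  split=> [|A A' KA KA']; first by apply: sumr_ge0 => i _.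
  apply: le_trans (hutchinson_op_contraction a0 aS KA KA') _.
  rewrite mulr_suml; apply: ler_sum => i _; rewrite ler_wpM2l//.
  exact: (le_bigmax _ (fun i => hausdorff_dist (A i) (A' i))).
have [l [LipE Fl la]] := Lip_lipschitz_with dD Fsum.
have l1 : l < 1 by exact: le_lt_trans a1.
have l01 : 0 <= l < 1 by rewrite l1 andbT; case: Fl.
have [r0 r1] := andP (ratio_bounds a0 a1).
move: r0 r1; set r : R := _ / _ => r0 r1.
have rE : r = (\sum_(i < p) a (lift ord0 i)) / (1 - a ord0) by [].
have boundE : bound = (Num.max l r)%:E by rewrite /bound LipE -EFin_max.
have EVl : lipschitz_with (Gamma X) dmax dmax (Num.max l r) (EV S).
  split=> [|g g' Gg Gg']; first by rewrite le_max r0 orbT.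
  have [KA AE] := iattractor_spec cX a0 a1 aS Gg.
  have [KA' AE'] := iattractor_spec cX a0 a1 aS Gg'.
  have [[KB _] [KB' _]] := (Gg, Gg').
  rewrite {1}/dmax ge_max; apply/andP; split.
    apply: le_trans (fixed_set_dist l01 Fl KA KA' KB KB' AE AE') _.
    apply: ler_pM; [by case/andP: l01|exact: hausdorff_dist_ge0| |];
      by rewrite /dmax le_max lexx.
  apply: le_trans (fixed_measure_dist cX a0 a1 aS
    (ihutchinson_measure_spec cX a0 a1 aS Gg) (ihutchinson_measure_spec cX a0 a1 aS Gg')) _.
  by apply: ler_pM => //; rewrite ?dMK_ge0// /dmax le_max lexx orbT.
have max1 : Num.max l r < 1 by rewrite gt_max l1.
have EVG := EV_Gamma cX a0 a1 aS.
have GS := attractor_Gamma cX a0 a1 aS.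
split=> //.
- by exists (Num.max l r).
- by rewrite boundE lte_fin; split => //; exact: Lip_le.
move=> g0 Gg0; apply: (contraction_iter_cvg _ _ EVG max1 EVl) => //.
- by move=> g g'; exact: dmax_ge0.
- by move=> g g' g''; exact: dmax_triangle.
(* The pair of the attractor and the Hutchinson measure satisfies the equations
   of its own image, whose solutions are unique up to distance zero. *)
have [KA AE] := iattractor_spec cX a0 a1 aS GS.
have [KS SE] := attractor_spec cX a1 aS.
rewrite /dmax ge_max /=; apply/andP; split.
  have SE' : hutchinson_op S (fam_cons (attractor S) (attractor S)) = attractor S.
    by rewrite fam_cons_same.
  apply: le_trans (fixed_set_dist l01 Fl KA KS KS KS AE SE') _.
  apply: mulr_ge0_le0; first by case/andP: l01.
  by apply/(hausdorff_dist_le _ KS KS); split=> x Ax; exists x => //; rewrite mdistxx.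
have MS : is_markov_image S (fam_cons (hutchinson_measure S) (hutchinson_measure S))
    (hutchinson_measure S).
  by rewrite fam_cons_same; exact: (hutchinson_measure_spec cX a0 a1 aS).
apply: le_trans (fixed_measure_dist cX a0 a1 aS
  (ihutchinson_measure_spec cX a0 a1 aS GS) MS) _.
apply: mulr_ge0_le0 => //; apply: dMK_le => f _.
by rewrite subrr normr0.
Qed.
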